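(* Let $\mathcal N$ be a semifinite von Neumann algebra on a Hilbert space $H$ with faithful normal semifinite trace $\tau$. Let $f:[-1,1]\to\mathbb R$ be a continuous odd function with $f(1)\neq 0$. Let $P,Q\in\mathcal N$ be projections with $P-Q\in\mathcal K_{\mathcal N}$ and $f(P-Q)$ trace class (i.e. $\tau(|f(P-Q)|)<\infty$). Then $$\operatorname{ind}(QP)=\frac{1}{f(1)}\,\tau\big[f(P-Q)\big],$$ where $\operatorname{ind}(QP)$ is the (Breuer-Fredholm) index of $QP$ as an operator from $PH$ to $QH$.
   Context: $\mathcal N$ has separable predual. $\mathcal K_{\mathcal N}$ denotes the norm-closed two-sided ideal of $\mathcal N$ generated by the elements of finite trace. For projections $P,Q\in\mathcal N$ with $P-Q\in\mathcal K_{\mathcal N}$, the operator $QP:PH\to QH$ is Breuer-Fredholm and its index is $$\operatorname{ind}(QP)=\tau([\operatorname{ran}P\cap\ker Q])-\tau([\ker P\cap\operatorname{ran}Q]),$$ where $[V]$ is the orthogonal projection onto the closed subspace $V$. *)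

(* Defs.v *)
From HB Require Import structures.
From mathcomp Require Import all_boot all_order all_algebra.
From mathcomp Require Import complex.
From mathcomp Require Import all_classical all_reals all_analysis.

Set Implicit Arguments.
Unset Strict Implicit.
Unset Printing Implicit Defensive.

Import Order.TTheory GRing.Theory Num.Theory.
Import numFieldNormedType.Exports.

Local Open Scope classical_set_scope.
Local Open Scope ring_scope.
Local Open Scope complex_scope.

(* Complex Hilbert spaces. The form is linear in its first argument and
   conjugate-linear in its second one; the norm is valued in R[i], as for every
   normedModType R[i]. *)
HB.mixin Record CompleteNormedModule_isHilbert (R : realType) H
    & CompleteNormedModule R[i] H := {
  hdot : {dot H for @Num.conj R[i]} ;
  hdot_norm : forall x : H, hdot x x = `|x| ^+ 2
}.

#[short(type="hilbertType")]
HB.structure Definition Hilbert (R : realType) :=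
  {H of CompleteNormedModule_isHilbert R H & CompleteNormedModule R[i] H}.

Notation "''[' u , v ]" := (hdot u v) : ring_scope.

Section Operators.
Context {R : realType} {H : hilbertType R}.
Implicit Types (T S A B P Q : H -> H) (N J : set (H -> H)).

Definition bounded_op T : Prop :=
  linear T /\ exists M : R, forall x, `|T x| <= M%:C * `|x|.

(* ||T - S|| <= e for the operator norm *)
Definition op_dist_le T S (e : R) : Prop :=
  forall x, `|T x - S x| <= e%:C * `|x|.

Definition is_adjoint T S : Prop := forall x y, '[T x, y] = '[x, S y].

Definition adj T : H -> H := xget (cst 0) [set S | is_adjoint T S].

Lemma adjE T S : is_adjoint T S -> adj T = S.
Proof.
move=> TS; apply: xget_unique => //= S' TS'; apply/funext => y.
apply/eqP; rewrite -subr_eq0 -normr_eq0 -sqrf_eq0 -hdot_norm; apply/eqP.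
by rewrite linearBr/= -TS -TS' subrr.
Qed.

(* The order of R[i] is partial: 0 <= z forces z to be real, so that, H being
   complex, positive operators are self-adjoint. *)
Definition op_le T S : Prop := forall x, '[T x, x] <= '[S x, x].

Definition positive_op T : Prop := bounded_op T /\ op_le (cst 0) T.

Definition commutant N : set (H -> H) :=
  [set T | bounded_op T /\ forall S, N S -> T \o S = S \o T].

Definition von_neumann_algebra N : Prop :=
  (forall T, N T -> exists2 S, N S & is_adjoint T S) /\
  commutant (commutant N) = N.

Definition is_projection P : Prop := P \o P = P /\ is_adjoint P P.

(* The predual of N: the ultraweakly continuous functionals
   T |-> \sum_i <T xi_i, eta_i>, with xi and eta square-summable. *)
Definition normal_functional N (phi : (H -> H) -> R[i]) : Prop :=
  exists xi eta : nat -> H,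
    [/\ exists M : R, forall n, \sum_(i < n) `|xi i| ^+ 2 <= M%:C,
        exists M : R, forall n, \sum_(i < n) `|eta i| ^+ 2 <= M%:C &
        forall T, N T ->
          (fun n => \sum_(i < n) '[T (xi i), eta i] : R[i]^o) @ \oo -->
          (phi T : R[i]^o)].

Definition separable_predual N : Prop :=
  exists phi_ : nat -> (H -> H) -> R[i],
    (forall k, normal_functional N (phi_ k)) /\
    forall phi, normal_functional N phi ->
    forall e : R, 0 < e -> exists k, forall T, N T ->
      (forall x, `|T x| <= `|x|) -> `|phi T - phi_ k T| <= e%:C.

(* A trace tau is a weight on the positive cone of N; its values elsewhere are
   irrelevant. *)
Definition pos_cone N : set (H -> H) := N `&` positive_op.

Definition is_lub N (D : set (H -> H)) A : Prop :=
  (forall B, D B -> op_le B A) /\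
  (forall S, N S -> (forall B, D B -> op_le B S) -> op_le A S).

Definition directed (D : set (H -> H)) : Prop :=
  D !=set0 /\ forall A B, D A -> D B -> exists S, [/\ D S, op_le A S & op_le B S].

Record faithful_normal_semifinite_trace N (tau : (H -> H) -> \bar R) : Prop := {
  trace_ge0 : forall A, pos_cone N A -> (0 <= tau A)%E ;
  traceD : forall A B, pos_cone N A -> pos_cone N B ->
    tau (A \+ B) = (tau A + tau B)%E ;
  traceZ : forall (r : R) A, 0 <= r -> pos_cone N A ->
    tau (fun x => r%:C *: A x) = (r%:E * tau A)%E ;
  trace_adj : forall T, N T -> tau (adj T \o T) = tau (T \o adj T) ;
  trace_faithful : forall A, pos_cone N A -> tau A = 0%E -> A = cst 0 ;
  trace_normal : forall (D : set (H -> H)) A,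
    D `<=` pos_cone N -> directed D -> pos_cone N A -> is_lub N D A ->
    tau A = ereal_sup [set tau B | B in D] ;
  trace_semifinite : forall A, pos_cone N A -> A <> cst 0 ->
    exists B, [/\ pos_cone N B, B <> cst 0, op_le B A & (tau B < +oo)%E]
}.

(* A = |T|, the positive square root of T^* T *)
Definition is_abs T A : Prop := positive_op A /\ A \o A = adj T \o T.

Definition trace_class N (tau : (H -> H) -> \bar R) T : Prop :=
  N T /\ exists2 A, is_abs T A & (tau A < +oo)%E.

(* The linear extension of tau to the self-adjoint trace-class elements *)
Definition trace_sa N (tau : (H -> H) -> \bar R) T : R :=
  xget 0 [set r | exists A B,
    [/\ pos_cone N A /\ (tau A < +oo)%E, pos_cone N B /\ (tau B < +oo)%E,
        T = A \- B & r = fine (tau A) - fine (tau B)]].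

Definition norm_closed_ideal N J : Prop :=
  [/\ J `<=` N, J (cst 0),
      forall T S, J T -> J S -> J (T \+ S),
      forall A T B, N A -> J T -> N B -> J (A \o T \o B) &
      forall T, bounded_op T ->
        (forall e : R, 0 < e -> exists2 S, J S & op_dist_le T S e) -> J T].

Definition compact_ideal N (tau : (H -> H) -> \bar R) : set (H -> H) :=
  [set T | forall J, norm_closed_ideal N J -> trace_class N tau `<=` J -> J T].

(* The orthogonal projection onto a closed subspace V *)
Definition proj (V : set H) : H -> H :=
  fun x => xget 0 [set y | V y /\ forall v, V v -> '[x - y, v] = 0].

Definition ker T : set H := T @^-1` [set 0].

(* The index of T = Q T P as an operator from P H to Q H; T is Breuer-Fredholm
   only if both terms are finite. *)
Definition bf_index (tau : (H -> H) -> \bar R) P Q T : \bar R :=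
  (tau (proj (range P `&` ker T)) - tau (proj (range Q `&` ker (adj T))))%E.

Lemma bf_index_projE (tau : (H -> H) -> \bar R) P Q :
  is_projection P -> is_projection Q ->
  bf_index tau P Q (Q \o P) =
  (tau (proj (range P `&` ker Q)) - tau (proj (ker P `&` range Q)))%E.
Proof.
move=> [PP Pa] [QQ Qa]; rewrite /bf_index.
have -> : adj (Q \o P) = P \o Q by apply: adjE => x y /=; rewrite Qa Pa.
have rk (A B : H -> H) : A \o A = A ->
    range A `&` ker (B \o A) = range A `&` ker B.
  move=> AA; have AAE x : A (A x) = A x by rewrite -[LHS]/((A \o A) x) AA.
  by apply/seteqP; split=> _ [[x _ <-]]; rewrite /ker /= AAE; split=> //; exists x.
by rewrite !rk// [ker P `&` _]setIC.
Qed.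

Definition poly_op (p : {poly R}) A : H -> H :=
  fun x => \sum_(i < size p) (p`_i)%:C *: iter i A x.

(* Continuous functional calculus f(A), for A self-adjoint with -1 <= A <= 1 and
   f continuous on [-1, 1]: the operator-norm limit of p(A) as the polynomial p
   tends to f uniformly on [-1, 1], an interval containing the spectrum of A. *)
Definition cfc (f : R -> R) A : H -> H :=
  xget (cst 0) [set T | forall e : R, 0 < e -> exists p : {poly R},
    (forall t, t \in `[-1, 1] -> `|p.[t] - f t| <= e) /\
    op_dist_le (poly_op p A) T e].

End Operators.

(* Main.v *)
Require Import Defs.
From HB Require Import structures.
From mathcomp Require Import all_boot all_order all_algebra.
From mathcomp Require Import complex.
From mathcomp Require Import all_classical all_reals all_analysis.
From mathcomp Require Import ring lra zify.

(* With A = P - Q and B = 1 - P - Q one has A^2 + B^2 = 1 and AB = -BA, and the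
   eigenspaces of A for 1 and -1 are the two spaces in the index. On these two
   spaces f(A) is f(1) and -f(1), which gives f(1) times the index. The rest of
   f(A) has trace zero: for the positive and negative parts of f,
   f_-(t) = f_+(-t), so that T = s(A) B with
   s^2 = f_+ (1 + t^2 + ... + t^(2n-2)) satisfies
   T T^* = f_+(A) (1 - A^2n) and T^* T = f_-(A) (1 - A^2n). These two operators
   have the same trace, and they increase to the parts of f_+(A) and f_-(A) off
   the eigenspaces. *)

Set Implicit Arguments.
Unset Strict Implicit.
Unset Printing Implicit Defensive.

Import Order.TTheory GRing.Theory Num.Theory.
Import numFieldNormedType.Exports.

Local Open Scope classical_set_scope.
Local Open Scope ring_scope.
Local Open Scope complex_scope.

(** The sign reversal coming from AB = -BA therefore has to be expressed through positive operators,
    which is why f is split into positive and negative parts; f itself may change sign inside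
    [0, 1]. The natural choice would be s^2 = f_+ / (1 - t^2), so that s(A) B^2 s(A) = f_+(A). Since
    f(1) is nonzero, this quotient blows up at an endpoint. The finite geometric sum is a truncation
    of 1 / (1 - t^2) that keeps s continuous, and normality of the trace removes the truncation. No
    spectral measure is used. The projection onto the span of the two eigenspaces is the strong
    limit of A^2n, and membership in the algebra is always read off the bicommutant. Trace-class
    f(A) makes both parts of f(A) finite in trace, and f(1) nonzero then makes both terms of the
    index finite. *)

(** * Weierstrass approximation on [-1, 1] *)

Section Weierstrass.
Context {R : realType}.
Implicit Types (f g : R -> R) (t s e : R).

Lemma itv11P t : reflect (-1 <= t /\ t <= 1) (t \in `[-1, 1]).
Proof. by rewrite in_itv; exact: andP. Qed.

Lemma continuous_itv11_bounded f : {within `[-1, 1], continuous f} ->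
  exists M : R, forall t, t \in `[-1, 1] -> `|f t| <= M.
Proof.
move=> fc; have fnc : {within `[-1, 1], continuous (fun t => `|f t|)}.
  by move=> x; exact: (continuous_comp (fc x) (@norm_continuous _ _ _)).
have le11 : (-1 : R) <= 1 by lra.
by have [c _ cM] := EVT_max le11 fnc; exists `|f c|.
Qed.

(** Heine-Cantor, through the near-covering form of compactness along d -> 0+: a modulus d valid
    near each point is valid on the whole segment. *)
Lemma continuous_itv11_unif f e : {within `[-1, 1], continuous f} -> 0 < e ->
  exists2 d : R, 0 < d & forall s t, s \in `[-1, 1] -> t \in `[-1, 1] ->
    `|s - t| < d -> `|f s - f t| <= e.
Proof.
move=> /subspace_continuousP fc e0.
have /compact_near_coveringP ncov := @segment_compact R (-1) 1.
pose p (d s : R) := s \in `[-1, 1] ->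
  forall t, t \in `[-1, 1] -> `|s - t| < d -> `|f s - f t| <= e.
have : \forall d \near 0^'+, `[-1, 1] `<=` p d.
  apply: ncov => x xI; have e20 : 0 < e / 2 by lra.
  have /cvgrPdist_le /(_ _ e20) := fc x xI.
  rewrite near_withinE => -[r /= r0 fr].
  (* Half of r for the distance from x to s and half for d, so that t stays within r of x. *)
  exists (ball x (r / 2), [set d | d < r / 2]); first split => /=.
  - by apply: nbhsx_ballx; rewrite divr_gt0.
  - by apply: nbhs_right_lt; rewrite divr_gt0.
  move=> [s d] /= [xs dr] sI t tI st.
  have fs : `|f x - f s| <= e / 2.
    apply: fr => //=; apply: (lt_trans xs); lra.
  have ft : `|f x - f t| <= e / 2.
    apply: fr => //=; rewrite -[x - t](subrKA s).
    by apply: (le_lt_trans (ler_normD _ _)); move: xs st; rewrite /ball/=; lra.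
  have -> : f s - f t = (f x - f t) - (f x - f s) by ring.
  by apply: (le_trans (ler_normB _ _)); lra.
move=> pnear; have [d d0 dP] : exists2 d : R, 0 < d & `[-1, 1] `<=` p d.
  near (0 : R)^'+ => d; exists d; near: d => //.
  exact: nbhs_right_gt.
by exists d => // s t sI tI; apply: dP.
Unshelve. all: by end_near. Qed.

(** A modulus of continuity in the form that Bernstein polynomials evaluate exactly. Beyond the
    uniform distance d one has (s - t)^2 / d^2 >= 1, so K = 2M / d^2 covers the crude bound 2M. *)
Lemma continuous_itv11_quad f e : {within `[-1, 1], continuous f} -> 0 < e ->
  exists2 K : R, 0 <= K & forall s t, s \in `[-1, 1] -> t \in `[-1, 1] ->
    `|f s - f t| <= e + K * (s - t) ^+ 2.
Proof.
move=> fc e0; have [M fM] := continuous_itv11_bounded fc.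
have [d d0 fd] := continuous_itv11_unif fc e0.
have M0 : 0 <= M.
  by apply: le_trans (fM 0 _) => //; apply/itv11P; lra.
have K0 : 0 <= 2 * M / d ^+ 2 by rewrite divr_ge0 ?sqr_ge0// mulr_ge0.
exists (2 * M / d ^+ 2) => // s t sI tI.
have [/fd-/(_ sI tI) st|st] := ltP `|s - t| d.
  by rewrite (le_trans st)// lerDl mulr_ge0 ?sqr_ge0.
apply: (@le_trans _ _ (2 * M)).
  by apply: (le_trans (ler_normB _ _)); have := fM _ sI; have := fM _ tI; lra.
apply: (@le_trans _ _ (2 * M * ((s - t) ^+ 2 / d ^+ 2))); last by lra.
rewrite -[leLHS]mulr1 ler_wpM2l ?mulr_ge0// ler_pdivlMr ?exprn_gt0// mul1r.
by rewrite -[(s - t) ^+ 2]real_normK ?num_real// lerXn2r ?nnegrE// ltW.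
Qed.

(* [bern n v] is the Bernstein polynomial of degree n on [-1, 1] with values
   v 0, ..., v n at the nodes, given by its binary splitting recursion: no
   binomial coefficient is needed. *)
Fixpoint bern (n : nat) (v : nat -> R) : {poly R} :=
  if n is n'.+1 then
    (2^-1 *: (1 - 'X)) * bern n' v + (2^-1 *: (1 + 'X)) * bern n' (v \o S)
  else (v 0%N)%:P.

Lemma bernS n v t : (bern n.+1 v).[t] =
  (1 - t) / 2 * (bern n v).[t] + (1 + t) / 2 * (bern n (v \o S)).[t].
Proof. by rewrite /= !hornerE; ring. Qed.

Lemma bern_le n v w t : t \in `[-1, 1] -> (forall k, (k <= n)%N -> v k <= w k) ->
  (bern n v).[t] <= (bern n w).[t].
Proof.
move=> /itv11P tI; elim: n v w => [|n IH] v w vw; first by rewrite !hornerE vw.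
rewrite !bernS lerD// ler_wpM2l ?IH//; try lra; move=> k kn; apply: vw => //.
exact: leqW.
Qed.

(** [(bern n v).[t]] is the mean of v at a binomial variable with n trials of probability (1 + t) /
    2. The right-hand side is its variance n (1 - t^2) / 4 plus the squared distance from its mean
    to a. *)
Lemma bern_quad n (a b c : R) t : (bern n (fun k => b + c * (k%:R - a) ^+ 2)).[t] =
  b + c * (n%:R * (1 - t ^+ 2) / 4 + (n%:R * (1 + t) / 2 - a) ^+ 2).
Proof.
elim: n a => [|n IH] a; first by rewrite /= hornerC; ring.
rewrite bernS IH (_ : _ \o S = fun k => b + c * (k%:R - (a - 1)) ^+ 2).
  by rewrite IH -natr1; field.
by apply/funext => k /=; rewrite -natr1; congr (_ + _ * _ ^+ _); ring.
Qed.

Theorem weierstrass f e : {within `[-1, 1], continuous f} -> 0 < e ->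
  exists p : {poly R}, forall t, t \in `[-1, 1] -> `|p.[t] - f t| <= e.
Proof.
move=> fc e0; have e20 : 0 < e / 2 by lra.
have [K K0 fK] := continuous_itv11_quad fc e20.
(* The variance term will contribute K (1 - t^2) / n, which this n keeps below e / 2. *)
pose n := (Num.truncn (2 * K / e)).+1.
have n0 : (0 : R) < n%:R by rewrite ltr0n.
have Kn : K / n%:R <= e / 2.
  rewrite ler_pdivrMr//.
  have : 2 * K / e < n%:R by rewrite truncnS_gt.
  by rewrite ltr_pdivrMr//; lra.
exists (bern n (fun k => f (2 * k%:R / n%:R - 1))) => t tI.
have /itv11P tI' := tI.
(* At the node s = 2k/n - 1, K (s - t)^2 equals c (k - a)^2. As a is the binomial mean, only the
   variance survives in [bern_quad]. Monotonicity then squeezes the polynomial between two exact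
   quadratics. *)
pose c := 4 * K / n%:R ^+ 2; pose a := n%:R * (1 + t) / 2.
have near_f k : (k <= n)%N ->
    `|f (2 * k%:R / n%:R - 1) - f t| <= e / 2 + c * (k%:R - a) ^+ 2.
  move=> kn; have kI : (2 : R) * k%:R / n%:R - 1 \in `[-1, 1].
    have kn' : (k%:R : R) <= n%:R by rewrite ler_nat.
    apply/itv11P; split; first by rewrite lerBrDr addNr divr_ge0 ?mulr_ge0.
    by rewrite lerBlDr ler_pdivrMr//; lra.
  apply: (le_trans (fK _ _ kI tI)); rewrite le_eqVlt; apply/orP; left; apply/eqP.
  by congr (_ + _); rewrite /c /a; field; rewrite gt_eqF.
have err : c * (n%:R * (1 - t ^+ 2) / 4 + (n%:R * (1 + t) / 2 - a) ^+ 2) <= e / 2.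
  rewrite /a subrr expr0n/= addr0 /c.
  have -> : 4 * K / n%:R ^+ 2 * (n%:R * (1 - t ^+ 2) / 4) =
    K / n%:R * (1 - t ^+ 2) by field; rewrite gt_eqF.
  apply: le_trans Kn; rewrite -[leRHS]mulr1 ler_wpM2l ?divr_ge0//.
  by have := sqr_ge0 t; lra.
rewrite ler_norml; apply/andP; split.
  have : (bern n (fun k => f t - e / 2 + (- c) * (k%:R - a) ^+ 2)).[t] <=
         (bern n (fun k => f (2 * k%:R / n%:R - 1))).[t].
    by apply: bern_le => // k /near_f; rewrite ler_norml => /andP[]; lra.
  by rewrite bern_quad; lra.
have : (bern n (fun k => f (2 * k%:R / n%:R - 1))).[t] <=
       (bern n (fun k => f t + e / 2 + c * (k%:R - a) ^+ 2)).[t].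
  by apply: bern_le => // k /near_f; rewrite ler_norml => /andP[]; lra.
by rewrite bern_quad; lra.
Qed.

End Weierstrass.

(** * The underlying real inner product space *)

Section RealHilbert.
Context {R : realType} {H : hilbertType R}.
Implicit Types (x y z u v : H) (r s : R) (S T A B : H -> H).

(* H is used as a real inner product space, so that inequalities are between
   real numbers rather than in the partial order of R[i]. *)
Definition ip x y : R := complex.Re '[x, y].
Definition nr x : R := complex.Re `|x|.

Lemma Re_rmul r (c : R[i]) : complex.Re (r%:C * c) = r * complex.Re c.
Proof. by case: c => a b /=; rewrite mul0r subr0. Qed.

Lemma hdotC x y : '[x, y] = ('[y, x])^*%C.
Proof. by rewrite [LHS]hermC expr0 mul1r. Qed.

Lemma ipC x y : ip x y = ip y x.
Proof. by rewrite /ip hdotC; case: '[y, x]. Qed.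

Lemma ipDl x y z : ip (x + y) z = ip x z + ip y z.
Proof. by rewrite /ip linearDl raddfD. Qed.

Lemma ipZl r x y : ip (r%:C *: x) y = r * ip x y.
Proof. by rewrite /ip linearZl_LR Re_rmul. Qed.

Lemma ipNl x y : ip (- x) y = - ip x y.
Proof. by rewrite /ip linearNl raddfN. Qed.

Lemma ipBl x y z : ip (x - y) z = ip x z - ip y z.
Proof. by rewrite ipDl ipNl. Qed.

Lemma ipDr x y z : ip z (x + y) = ip z x + ip z y.
Proof. by rewrite !(ipC z) ipDl. Qed.

Lemma ipZr r x y : ip y (r%:C *: x) = r * ip y x.
Proof. by rewrite !(ipC y) ipZl. Qed.

Lemma ipBr x y z : ip z (x - y) = ip z x - ip z y.
Proof. by rewrite !(ipC z) ipBl. Qed.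

Lemma ip0l x : ip 0 x = 0.
Proof. by rewrite -(subrr 0) ipBl subrr. Qed.

Lemma normE x : `|x| = (nr x)%:C.
Proof. by rewrite /nr RRe_real// normr_real. Qed.

Lemma nr_ge0 x : 0 <= nr x.
Proof. by rewrite -ler0c -normE. Qed.

Lemma hdotxx x : '[x, x] = (nr x ^+ 2)%:C.
Proof. by rewrite hdot_norm normE rmorphXn. Qed.

Lemma ipxx x : ip x x = nr x ^+ 2.
Proof. by rewrite /ip hdotxx. Qed.

Lemma nr_eq0 x : nr x = 0 -> x = 0.
Proof. by move=> x0; apply/eqP; rewrite -normr_eq0 normE x0. Qed.

Lemma nr0 : nr 0 = 0.
Proof. by rewrite /nr normr0. Qed.

Lemma nrD x y : nr (x + y) <= nr x + nr y.
Proof. by rewrite -lecR rmorphD/= -!normE ler_normD. Qed.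

Lemma nrZ r x : nr (r%:C *: x) = `|r| * nr x.
Proof.
apply: complexI; rewrite -normE normrZ normE rmorphM/=; congr (_ * _).
by rewrite normc_def /= expr0n/= addr0 sqrtr_sqr.
Qed.

Lemma nrN x : nr (- x) = nr x.
Proof. by rewrite /nr normrN. Qed.

Lemma nr_sub x y : nr (x - y) = nr (y - x).
Proof. by rewrite -nrN opprB. Qed.

Lemma nr_subD y x z : nr (x - z) <= nr (x - y) + nr (y - z).
Proof. by rewrite -(subrKA y) nrD. Qed.

Lemma le_opnorm r x y : (`|x| <= r%:C * `|y|) = (nr x <= r * nr y).
Proof. by rewrite !normE -rmorphM/= lecR. Qed.

Lemma cauchy_schwarz x y : `|ip x y| <= nr x * nr y.
Proof.
have [y0|y0] := eqVneq (nr y) 0.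
  by rewrite (nr_eq0 y0) ipC ip0l normr0 nr0 mulr0.
have y2 : 0 < nr y ^+ 2 by rewrite exprn_even_gt0.
pose c := ip x y / nr y ^+ 2.
have := sqr_ge0 (nr (x - c%:C *: y)).
rewrite -ipxx ipBl !ipBr !ipZl !ipZr (ipC y) !ipxx => Hc.
rewrite -ler_sqr ?nnegrE ?mulr_ge0 ?nr_ge0// real_normK ?num_real//.
rewrite exprMn -ler_pdivrMr//.
have -> : ip x y ^+ 2 / nr y ^+ 2 = c * ip x y by rewrite /c; ring.
have cy : c * nr y ^+ 2 = ip x y by rewrite /c divfK// gt_eqF.
by move: Hc; rewrite cy; lra.
Qed.

Lemma ip_le x y : ip x y <= nr x * nr y.
Proof. exact: le_trans (ler_norm _) (cauchy_schwarz x y). Qed.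

Lemma ip_ge x y : - (nr x * nr y) <= ip x y.
Proof. by have := cauchy_schwarz x y; rewrite ler_norml => /andP[]. Qed.

Lemma ip_inj x y : (forall z, ip x z = ip y z) -> x = y.
Proof.
move=> xy; apply/eqP; rewrite -subr_eq0; apply/eqP/nr_eq0/eqP.
by rewrite -sqrf_eq0 -ipxx ipBl xy subrr.
Qed.

Lemma linD T x y : linear T -> T (x + y) = T x + T y.
Proof. by move=> lT; have := lT 1 x y; rewrite !scale1r. Qed.

Lemma lin0 T : linear T -> T 0 = 0.
Proof. by move=> lT; have := lT (-1) 0 0; rewrite !scaleN1r oppr0 addr0 addNr. Qed.

Lemma linZ T (c : R[i]) x : linear T -> T (c *: x) = c *: T x.
Proof. by move=> lT; have := lT c x 0; rewrite !addr0 (lin0 lT) addr0. Qed.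

Lemma linN T x : linear T -> T (- x) = - T x.
Proof. by move=> lT; rewrite -scaleN1r linZ// scaleN1r. Qed.

Lemma linB T x y : linear T -> T (x - y) = T x - T y.
Proof. by move=> lT; rewrite linD// linN. Qed.

Lemma lin_comp S T : linear S -> linear T -> linear (S \o T).
Proof. by move=> lS lT c x y /=; rewrite lT lS. Qed.

Lemma linP T : (forall x y, T (x + y) = T x + T y) ->
  (forall (c : R[i]) x, T (c *: x) = c *: T x) -> linear T.
Proof. by move=> TD TZ c x y; rewrite TD TZ. Qed.

Lemma is_adjoint_ip S T x y : is_adjoint S T -> ip (S x) y = ip x (T y).
Proof. by move=> ST; rewrite /ip ST. Qed.

Lemma Im_hdot x y : complex.Im '[x, y] = ip x ('i%C *: y).
Proof.
by rewrite /ip linearZr_LR/=; case: '[x, y] => a b /=; ring.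
Qed.

(** The real identity at y gives the real parts, and at ['i *: y] the imaginary parts, once T is
    moved across 'i by complex linearity. *)
Lemma ip_is_adjoint S T : linear T ->
  (forall x y, ip (S x) y = ip x (T y)) -> is_adjoint S T.
Proof.
move=> lT ST x y; apply/eqP; rewrite eq_complex !Im_hdot -(linZ _ _ lT) -!ST eqxx andbT.
by apply/eqP; exact: ST.
Qed.

Lemma selfadjoint_Im T x : is_adjoint T T -> complex.Im '[T x, x] = 0.
Proof.
move=> aT; have := hdotC (T x) x; rewrite -aT.
by case: '[_, _] => a b /= [] ; lra.
Qed.

Lemma selfadjoint_op_le S T : is_adjoint S S -> is_adjoint T T ->
  op_le S T <-> forall x, ip (S x) x <= ip (T x) x.
Proof.
by move=> aS aT; split=> le x; have := le x;
  rewrite lecE !selfadjoint_Im// eqxx.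
Qed.

Lemma ip_op_le S T x : op_le S T -> ip (S x) x <= ip (T x) x.
Proof. by move=> /(_ x); rewrite lecE => /andP[]. Qed.

End RealHilbert.

(** * Polynomials in a self-adjoint contraction: positivity and norm bounds *)

Section PolynomialCalculus.
Context {R : realType} {H : hilbertType R}.
Implicit Types (x y z u v : H) (r s t : R) (S T A B : H -> H) (p q : {poly R}).

Lemma poly_op_widen n p A x : (size p <= n)%N ->
  poly_op p A x = \sum_(i < n) (p`_i)%:C *: iter i A x.
Proof.
move=> pn; rewrite /poly_op (big_ord_widen n (fun i => (p`_i)%:C *: iter i A x))//.
rewrite [RHS](bigID (fun i : 'I_n => (i < size p)%N))/= [X in _ = _ + X]big1 ?addr0//.
by move=> i; rewrite -leqNgt => pi; rewrite nth_default// scale0r.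
Qed.

Lemma poly_opD p q A x : poly_op (p + q) A x = poly_op p A x + poly_op q A x.
Proof.
rewrite !(@poly_op_widen (maxn (size p) (size q))) ?leq_maxl ?leq_maxr//; last first.
  exact: size_polyD.
by rewrite -big_split/=; apply: eq_bigr => i _; rewrite coefD rmorphD scalerDl.
Qed.

Lemma poly_opZ r p A x : poly_op (r *: p) A x = r%:C *: poly_op p A x.
Proof.
rewrite (@poly_op_widen (size p)) ?size_scale_leq// scaler_sumr.
by apply: eq_bigr => i _; rewrite coefZ rmorphM scalerA.
Qed.

Lemma poly_opC r A x : poly_op r%:P A x = r%:C *: x.
Proof.
rewrite (@poly_op_widen 1) ?size_polyC; last by case: (r != 0).
by rewrite big_ord1 coefC.
Qed.

Lemma poly_op1 A x : poly_op 1 A x = x.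
Proof. by rewrite poly_opC scale1r. Qed.

Lemma poly_opMX p A x : poly_op (p * 'X) A x = poly_op p A (A x).
Proof.
rewrite (@poly_op_widen (size p).+1); last first.
  by rewrite (leq_trans (size_polyMleq _ _))// size_polyX addn2.
rewrite big_ord_recl coefMX scale0r add0r; apply: eq_bigr => i _.
by rewrite coefMX/= add0n -iterSr.
Qed.

Lemma poly_opX A x : poly_op 'X A x = A x.
Proof. by rewrite -['X]mul1r poly_opMX poly_op1. Qed.

Lemma poly_opB p q A x : poly_op (p - q) A x = poly_op p A x - poly_op q A x.
Proof. by rewrite -[- q]scaleN1r poly_opD poly_opZ rmorphN1 scaleN1r. Qed.

(** Two operators A and B are allowed so that both commutation (B = A) and anticommutation (B = -A)
    are covered. *)
Lemma poly_op_intertwine p S A B x : linear S ->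
  (forall z, S (A z) = B (S z)) -> S (poly_op p A x) = poly_op p B (S x).
Proof.
move=> lS SAB; elim/poly_ind: p x => [|p c IH] x.
  by rewrite !poly_opC !scale0r lin0.
by rewrite !poly_opD linD// !poly_opMX IH SAB !poly_opC linZ.
Qed.

Lemma poly_op_linear p A : linear A -> linear (poly_op p A).
Proof.
move=> lA; elim/poly_ind: p => [|p c IH] a x y.
  by rewrite !poly_opC !scale0r scaler0 addr0.
rewrite !poly_opD !poly_opMX lA IH !poly_opC !scalerDr !scalerA mulrC.
by rewrite addrACA.
Qed.

Lemma poly_opM p q A x : linear A ->
  poly_op (p * q) A x = poly_op p A (poly_op q A x).
Proof.
move=> lA; elim/poly_ind: p q x => [|p c IH] q x.
  by rewrite mul0r !poly_opC !scale0r.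
rewrite mulrDl -mulrA mul_polyC !poly_opD poly_opZ poly_opC; congr (_ + _).
rewrite IH ['X * q]mulrC !poly_opMX; congr (poly_op p A _).
by rewrite (@poly_op_intertwine q A A A).
Qed.


(** For a self-adjoint operator, norm at most 1 means spectrum inside [-1, 1]; this form avoids
    speaking of the spectrum. *)
Definition sa_contraction A : Prop :=
  [/\ linear A, is_adjoint A A & forall x, nr (A x) <= nr x].

Lemma poly_op_adjoint p A x y : sa_contraction A ->
  ip (poly_op p A x) y = ip x (poly_op p A y).
Proof.
move=> [lA aA _]; elim/poly_ind: p x y => [|p c IH] x y.
  by rewrite !poly_opC ipZl ipZr.
rewrite !poly_opD ipDl ipDr !poly_opMX !poly_opC ipZl ipZr; congr (_ + _).
rewrite IH (is_adjoint_ip _ _ aA); congr (ip x _).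
exact: poly_op_intertwine.
Qed.

(* Every polynomial which is positive on [-1, 1] lies in the cone generated by
   the q^2 (1 + X)^a (1 - X)^b, on which positivity at A is elementary. *)
Inductive pos_gen : {poly R} -> Prop :=
| pos_gen1 q (a b : nat) : pos_gen (q ^+ 2 * ((1 + 'X) ^+ a * (1 - 'X) ^+ b))
| pos_genD p q : pos_gen p -> pos_gen q -> pos_gen (p + q).

Lemma pos_genM p q : pos_gen p -> pos_gen q -> pos_gen (p * q).
Proof.
move=> gp; elim: gp q => {p} [p a b q|p1 p2 _ IH1 _ IH2 q gq]; last first.
  by rewrite mulrDl; apply: pos_genD; [exact: IH1|exact: IH2].
elim=> {q} [q c d|q1 q2 _ IH1 _ IH2]; last by rewrite mulrDr; exact: pos_genD.
by rewrite mulrACA -exprMn [X in _ * X]mulrACA -!exprD; exact: pos_gen1.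
Qed.

Lemma pos_gen_sqr q : pos_gen (q ^+ 2).
Proof. by have := pos_gen1 q 0 0; rewrite !expr0 !mulr1. Qed.

Lemma pos_genC r : 0 <= r -> pos_gen r%:P.
Proof.
by move=> r0; rewrite -(sqr_sqrtr r0) rmorphXn/=; exact: pos_gen_sqr.
Qed.

Lemma pos_gen_X1 : pos_gen (1 + 'X).
Proof. by have := pos_gen1 1 1 0; rewrite expr1n expr0 expr1 mul1r mulr1. Qed.

Lemma pos_gen_1X : pos_gen (1 - 'X).
Proof. by have := pos_gen1 1 0 1; rewrite expr1n expr0 expr1 !mul1r. Qed.

(** The remainder of p modulo the quadratic has degree at most 1 and vanishes at a + ib. Its
    imaginary part there is b times the coefficient of X, so both coefficients are zero. *)
Lemma divides_quadratic p (a b : R) : b != 0 ->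
  root (map_poly (real_complex R) p) (a +i* b) ->
  exists q, p = q * (('X - a%:P) ^+ 2 + (b ^+ 2)%:P).
Proof.
move=> b0 rp; set d := _ + _; exists (divp p d).
have dE : d = ('X - a%:P) * ('X - a%:P) + (b ^+ 2)%:P by rewrite /d expr2.
have sd : size d = 3%N.
  rewrite /d size_polyDl; first by rewrite size_exp_XsubC.
  by rewrite size_exp_XsubC size_polyC; case: (_ != 0).
have d0 : d != 0 by rewrite -size_poly_eq0 sd.
have sr : (size (modp p d) <= 2)%N by rewrite -ltnS -sd ltn_modp.
suff r0 : modp p d = 0 by rewrite {1}(divp_eq p d) r0 addr0.
have dz : (map_poly (real_complex R) d).[a +i* b] = 0.
  rewrite /d rmorphD/= rmorphXn/= rmorphB/= map_polyX !map_polyC/= !hornerE/=.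
  by apply/eqP; rewrite eq_complex/=; apply/andP; split; apply/eqP; ring.
move: rp; rewrite /root {1}(divp_eq p d) rmorphD/= rmorphM/= hornerD hornerM dz.
rewrite mulr0 add0r => /eqP rz.
move: rz; rewrite (horner_coef_wide (n := 2)) ?size_map_poly//.
rewrite !big_ord_recl big_ord0 !coef_map/= expr0 expr1 mulr1 addr0 => rz.
have /eqP := rz; rewrite eq_complex/= !mul0r !add0r !subr0 addr0.
move=> /andP[/eqP re /eqP im].
have c1 : (modp p d)`_1 = 0.
  by apply/eqP; move/eqP: im; rewrite mulf_eq0 (negbTE b0) orbF.
have c0 : (modp p d)`_0 = 0 by move: re; rewrite c1 mul0r addr0.
apply/polyP => i; rewrite coef0; case: i => [|[|i]]//.
by rewrite nth_default// (leq_trans sr).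
Qed.

(** Induction on the size, splitting off a complex root. Strict positivity puts a real root a
    outside [-1, 1], and its factor is (1 + X) + (-1 - a) or (1 - X) + (a - 1), with a nonnegative
    constant. A nonreal root gives a square plus a nonnegative constant. In each case the quotient
    is again positive on the interval. *)
Lemma pos_gen_pos p : (forall t, t \in `[-1, 1] -> 0 < p.[t]) -> pos_gen p.
Proof.
move: {2}(size p) (leqnn (size p)) => n; elim: n p => [|n IH] p.
  rewrite leqn0 size_poly_eq0 => /eqP-> /(_ 0); rewrite horner0 ltxx.
  by move=> /(_ _)/wrap[]//; apply/itv11P; split; lra.
have [/eqP sp _|sp] := boolP (size p == 1%N).
  have -> : p = (p`_0)%:P by apply: size1_polyC; rewrite sp.
  move=> /(_ 0); rewrite hornerC => p0; apply/pos_genC/ltW/p0.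
  by apply/itv11P; split; lra.
move=> pn p_gt0.
have [[a b] rz] : exists c, root (map_poly (real_complex R) p) c.
  by apply/closed_rootP; rewrite size_map_poly.
have [b0|b0] := eqVneq b 0.
  have ra : root p a.
    by move: rz; rewrite b0 (_ : a +i* 0 = real_complex R a)// fmorph_root.
  have /factor_theorem[q pE] := ra.
  have q0 : q != 0.
    apply: contraL sp => /eqP q0; move: p_gt0 => /(_ 0); rewrite pE q0 mul0r.
    rewrite horner0 ltxx => /(_ _)/wrap[]//; apply/itv11P; split; lra.
  have sq : (size q <= n)%N.
    by move: pn; rewrite pE size_Mmonic ?monicXsubC// size_XsubC addn2.
  have a_out : ~ (-1 <= a /\ a <= 1).
    by move=> /itv11P/p_gt0; move: ra => /eqP->; rewrite ltxx.
  have [a1|a1] := ltP a (-1).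
    rewrite pE; apply: pos_genM; last first.
      have -> : 'X - a%:P = (1 + 'X) + (-1 - a)%:P by rewrite rmorphB rmorphN1; ring.
      by apply: pos_genD pos_gen_X1 _; apply: pos_genC; lra.
    apply: IH => // t tI; have := p_gt0 _ tI; rewrite pE !hornerE pmulr_lgt0//.
    by move/itv11P: tI; lra.
  have a1' : 1 < a by rewrite ltNge; apply/negP => ?; exact: a_out.
  have {}pE : p = (- q) * (a%:P - 'X) by rewrite pE; ring.
  rewrite pE; apply: pos_genM; last first.
    have -> : a%:P - 'X = (1 - 'X) + (a - 1)%:P by rewrite rmorphB rmorph1; ring.
    by apply: pos_genD pos_gen_1X _; apply: pos_genC; lra.
  apply: IH => [|t tI]; first by rewrite size_polyN.
  have := p_gt0 _ tI; rewrite pE !hornerE pmulr_lgt0//.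
  by move/itv11P: tI; lra.
have [q pE] := divides_quadratic b0 rz.
set d := _ + _ in pE.
have d_gt0 t : 0 < d.[t].
  by rewrite /d !hornerE ltr_wpDl ?sqr_ge0// exprn_even_gt0.
have sd : size d = 3%N.
  rewrite /d size_polyDl; first by rewrite size_exp_XsubC.
  by rewrite size_exp_XsubC size_polyC; case: (_ != 0).
have d0 : d != 0 by rewrite -size_poly_eq0 sd.
have q0 : q != 0.
  apply: contraL sp => /eqP q0; move: p_gt0 => /(_ 0); rewrite pE q0 mul0r.
  rewrite horner0 ltxx => /(_ _)/wrap[]//; apply/itv11P; split; lra.
have sq : (size q <= n)%N.
  move: pn; rewrite pE size_mul// sd addn3/= ltnS; exact: leq_trans.
rewrite pE; apply: pos_genM.
  by apply: IH => // t tI; have := p_gt0 _ tI; rewrite pE hornerM pmulr_lgt0.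
apply: pos_genD; first exact: pos_gen_sqr.
by apply: pos_genC; rewrite sqr_ge0.
Qed.

Lemma poly_op_pos_gen p A x : sa_contraction A -> pos_gen p ->
  0 <= ip (poly_op p A x) x.
Proof.
move=> sA; have [lA aA cA] := sA.
elim=> {p} [q a b|p q _ IHp _ IHq]; last by rewrite poly_opD ipDl addr_ge0.
have bnd y : - nr y ^+ 2 <= ip (A y) y <= nr y ^+ 2.
  have nA : nr (A y) * nr y <= nr y ^+ 2.
    by rewrite expr2 ler_wpM2r ?nr_ge0.
  by rewrite (le_trans _ (ip_ge _ _)) ?lerN2// (le_trans (ip_le _ _)).
(* The even parts of the exponents join the square: the polynomial becomes s w s with w among 1, 1 +
   X, 1 - X and 1 - X^2. By self-adjointness only w(A) has to be tested, at y = s(A) x. *)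
have -> : q ^+ 2 * ((1 + 'X) ^+ a * (1 - 'X) ^+ b) =
    (q * ((1 + 'X) ^+ a./2 * (1 - 'X) ^+ b./2)) *
    (((1 + 'X) ^+ odd a * (1 - 'X) ^+ odd b) *
     (q * ((1 + 'X) ^+ a./2 * (1 - 'X) ^+ b./2))).
  rewrite -[in LHS](odd_double_half a) -[in LHS](odd_double_half b) -!addnn !exprD.
  by ring.
set s := q * (_ * _); rewrite poly_opM// (poly_op_adjoint _ _ _ sA) poly_opM//.
set y := poly_op s A x.
case: (odd a) (odd b) => [] [] /=; rewrite ?expr0 ?expr1 ?mul1r ?mulr1.
- have -> : (1 + 'X) * (1 - 'X) = 1 - 'X * 'X :> {poly R} by ring.
  rewrite poly_opB poly_op1 poly_opMX poly_opX.
  rewrite ipBl (is_adjoint_ip _ _ aA) !ipxx subr_ge0.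
  by rewrite lerXn2r ?nnegrE ?nr_ge0.
- by rewrite poly_opD poly_op1 poly_opX ipDl ipxx; have := bnd y; lra.
- by rewrite poly_opB poly_op1 poly_opX ipBl ipxx; have := bnd y; lra.
- by rewrite poly_op1 ipxx sqr_ge0.
Qed.

(** [pos_gen_pos] wants strict positivity, so a constant d is added. It costs d |x|^2, and d is
    chosen to make this at most e. *)
Lemma poly_op_ge0 p A x : sa_contraction A ->
  (forall t, t \in `[-1, 1] -> 0 <= p.[t]) -> 0 <= ip (poly_op p A x) x.
Proof.
move=> sA p0; apply/ler_addgt0Pr => e e0.
pose d := e / (nr x ^+ 2 + 1).
have d0 : 0 < d by rewrite divr_gt0// ltr_wpDl// sqr_ge0.
have : 0 <= ip (poly_op (p + d%:P) A x) x.
  apply: poly_op_pos_gen => //; apply: pos_gen_pos => t tI.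
  by rewrite !hornerE ltr_wpDl// p0.
rewrite poly_opD poly_opC ipDl ipZl ipxx.
suff : d * nr x ^+ 2 <= e by lra.
have n1 : 0 < nr x ^+ 2 + 1 by rewrite ltr_wpDl// sqr_ge0.
by rewrite /d mulrAC ler_pdivrMr// ler_wpM2l ?ltW//; lra.
Qed.

(** Positivity of c^2 - p^2 at A is the squared form of the bound. *)
Lemma poly_op_le p A (c : R) x : sa_contraction A ->
  (forall t, t \in `[-1, 1] -> `|p.[t]| <= c) -> nr (poly_op p A x) <= c * nr x.
Proof.
move=> sA pc; have [lA _ _] := sA.
have c0 : 0 <= c.
  by apply: le_trans (pc 0 _) => //; apply/itv11P; split; lra.
rewrite -ler_sqr ?nnegrE ?mulr_ge0 ?nr_ge0//.
have := @poly_op_ge0 ((c ^+ 2)%:P - p * p) A x sA.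
rewrite poly_opB poly_opM// poly_opC ipBl ipZl.
rewrite (poly_op_adjoint _ _ _ sA) !ipxx exprMn => pos.
rewrite -subr_ge0; apply: pos => t /pc.
rewrite !hornerE -expr2 subr_ge0 -[p.[t] ^+ 2]real_normK ?num_real//.
by rewrite ler_sqr ?nnegrE.
Qed.

End PolynomialCalculus.

(** * Continuous functional calculus on [-1, 1] *)

Section FunctionalCalculus.
Context {R : realType} {H : hilbertType R}.
Implicit Types (x y z u v : H) (r s t : R) (S T A B : H -> H) (p q : {poly R}).
Implicit Types (f g : R -> R).

Lemma nr_small z (K : R) : (forall e : R, 0 < e -> nr z <= e * K) -> z = 0.
Proof.
move=> zK; apply/nr_eq0/le_anti; rewrite nr_ge0 andbT.
apply/ler_addgt0Pr => e e0; rewrite add0r.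
have K0 : 0 <= K by have := zK 1 ltr01; rewrite mul1r; exact/le_trans/nr_ge0.
have K1 : 0 < K + 1 by lra.
apply: (le_trans (zK (e / (K + 1)) _)); first by rewrite divr_gt0.
by rewrite mulrAC ler_pdivrMr// ler_wpM2l ?ltW//; lra.
Qed.

Lemma hilbert_complete (a : nat -> H) :
  (forall e : R, 0 < e -> exists n, forall m, (n <= m)%N -> nr (a n - a m) <= e) ->
  exists l, forall e : R, 0 < e -> exists n, forall m, (n <= m)%N -> nr (a m - l) <= e.
Proof.
move=> ca; have : cvg (a @ \oo).
  apply/cauchy_cvgP/cauchy_exP => e e0.
  have eE : e = (complex.Re e)%:C by rewrite RRe_real// gtr0_real.
  have e0' : 0 < complex.Re e by rewrite -ltcR -eE.
  have e20 : 0 < complex.Re e / 2 by lra.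
  have [n an] := ca _ e20; exists (a n).
  exists n => // m /= nm; rewrite -ball_normE/= normE eE ltcR.
  by apply: (le_lt_trans (an _ nm)); lra.
move=> /cvg_ex[l /cvgrPdist_le al]; exists l => e e0.
have /al[n _ an] : (0 : R[i]) < e%:C by rewrite ltcR.
by exists n => m /an; rewrite normE lecR nr_sub.
Qed.

(** The property by which [cfc] selects its value. As a relation it can be proved of explicit
    operators, such as a product S B^2 S, which [is_cfc_unique] then identifies. *)
Definition is_cfc f A T : Prop := forall e : R, 0 < e -> exists p : {poly R},
  (forall t, t \in `[-1, 1] -> `|p.[t] - f t| <= e) /\
  op_dist_le (poly_op p A) T e.

Lemma op_dist_leP S T (e : R) : op_dist_le S T e <->
  forall x, nr (S x - T x) <= e * nr x.
Proof. by split=> ST x; have := ST x; rewrite le_opnorm. Qed.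

(** The definition controls only the polynomial it supplies. Any other p near f is compared with a
    supplied q whose error c is arbitrarily small; c enters twice, whence the factor 2 in its
    denominator. *)
Lemma is_cfc_approx f A T p (e : R) x : sa_contraction A -> is_cfc f A T ->
  (forall t, t \in `[-1, 1] -> `|p.[t] - f t| <= e) ->
  nr (poly_op p A x - T x) <= e * nr x.
Proof.
move=> sA fT pf; apply/ler_addgt0Pr => d d0.
pose c := d / (2 * nr x + 1).
have n1 : 0 < 2 * nr x + 1 by rewrite ltr_wpDl// mulr_ge0// nr_ge0.
have [q [qf /op_dist_leP qT]] := fT c (divr_gt0 d0 n1).
apply: (le_trans (nr_subD (poly_op q A x) _ _)).
have pq : nr (poly_op p A x - poly_op q A x) <= (e + c) * nr x.
  rewrite -poly_opB; apply: poly_op_le => // t tI; rewrite !hornerE.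
  rewrite -(subrKA (f t)); apply: (le_trans (ler_normD _ _)).
  by apply: lerD; [exact: pf|rewrite distrC; exact: qf].
have : c * (2 * nr x) <= d.
  by rewrite /c mulrAC ler_pdivrMr// ler_wpM2l ?ltW//; lra.
by have := qT x; lra.
Qed.

Lemma is_cfc_unique f A T S : sa_contraction A -> is_cfc f A T -> is_cfc f A S ->
  T = S.
Proof.
move=> sA fT fS; apply/funext => x; apply/eqP; rewrite -subr_eq0; apply/eqP.
apply: (@nr_small _ (2 * nr x)) => e e0; have [p [pf _]] := fT e e0.
apply: (le_trans (nr_subD (poly_op p A x) _ _)); rewrite nr_sub.
have := is_cfc_approx x sA fT pf; have := is_cfc_approx x sA fS pf; lra.
Qed.

Lemma cfcE f A T : sa_contraction A -> is_cfc f A T -> cfc f A = T.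
Proof.
by move=> sA fT; apply: xget_unique => // S fS; exact: is_cfc_unique sA fS fT.
Qed.

Lemma invn_small (e : R) : 0 < e -> exists n : nat, n.+1%:R^-1 <= e.
Proof.
move=> e0; exists (Num.truncn e^-1); rewrite invf_ple ?posrE ?ltr0n//.
by apply/ltW/truncnS_gt.
Qed.

Lemma is_cfc_ex f A : sa_contraction A -> {within `[-1, 1], continuous f} ->
  exists T, is_cfc f A T.
Proof.
move=> sA fc.
have approx n : exists p : {poly R}, forall t, t \in `[-1, 1] ->
    `|p.[t] - f t| <= n.+1%:R^-1.
  by apply: weierstrass => //; rewrite invr_gt0.
have [P Pf] := choice approx.
have PP n m x : (n <= m)%N ->
    nr (poly_op (P n) A x - poly_op (P m) A x) <= (2 * n.+1%:R^-1) * nr x.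
  move=> nm; rewrite -poly_opB; apply: poly_op_le => // t tI; rewrite !hornerE.
  rewrite -(subrKA (f t)); apply: (le_trans (ler_normD _ _)).
  have : m.+1%:R^-1 <= n.+1%:R^-1 :> R.
    by rewrite lef_pV2 ?posrE ?ltr0n// ler_nat.
  have := Pf n t tI; have := Pf m t tI; rewrite [`|f t - _|]distrC.
  by move: (m.+1%:R^-1) (n.+1%:R^-1) => a b; lra.
have lim x : exists l, forall e : R, 0 < e -> exists n, forall m, (n <= m)%N ->
    nr (poly_op (P m) A x - l) <= e.
  apply: hilbert_complete => e e0.
  have n1 : 0 < 2 * nr x + 1 by rewrite ltr_wpDl// mulr_ge0// nr_ge0.
  have [n ne] := invn_small (divr_gt0 e0 n1).
  exists n => m nm; apply: (le_trans (PP _ _ _ nm)); rewrite mulrAC.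
  apply: (@le_trans _ _ (2 * nr x * (e / (2 * nr x + 1)))).
    by rewrite ler_wpM2l// mulr_ge0// nr_ge0.
  by rewrite mulrCA ler_piMr ?(ltW e0)// ler_pdivrMr//; lra.
have [T TP] := choice lim; exists T => e e0.
have e20 : 0 < e / 2 by lra.
have [n ne] := invn_small e20; exists (P n); split=> [t tI|].
  by apply: (le_trans (Pf _ _ tI)); apply: (le_trans ne); lra.
apply/op_dist_leP => x; apply/ler_addgt0Pr => d d0.
(* The index k depends on x, but it only serves the intermediate term. The bound that remains comes
   from n, which is uniform in x. *)
have [k kT] := TP x d d0.
apply: (le_trans (nr_subD (poly_op (P (maxn n k)) A x) _ _)).
apply: lerD; last by apply: kT; exact: leq_maxr.
apply: (le_trans (PP _ _ _ (leq_maxl _ _))).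
by rewrite ler_wpM2r ?nr_ge0// mulrC -ler_pdivlMr.
Qed.

Lemma cfcP f A : sa_contraction A -> {within `[-1, 1], continuous f} ->
  is_cfc f A (cfc f A).
Proof. by move=> sA /(is_cfc_ex sA)[T fT]; rewrite (cfcE sA fT). Qed.

Lemma is_cfc_ext f g A T : (forall t, t \in `[-1, 1] -> f t = g t) ->
  is_cfc f A T -> is_cfc g A T.
Proof.
move=> fg fT e e0; have [p [pf pT]] := fT e e0; exists p; split=> // t tI.
by rewrite -fg// pf.
Qed.

Lemma is_cfc_poly p A : is_cfc (horner p) A (poly_op p A).
Proof.
move=> e e0; exists p; split=> [t _|x]; first by rewrite subrr normr0 ltW.
by rewrite subrr le_opnorm nr0 mulr_ge0 ?nr_ge0// ltW.
Qed.

Lemma is_cfcD f g A T S : is_cfc f A T -> is_cfc g A S ->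
  is_cfc (fun t => f t + g t) A (T \+ S).
Proof.
move=> fT gS e e0; have e20 : 0 < e / 2 by lra.
have [p [pf /op_dist_leP pT]] := fT _ e20.
have [q [qg /op_dist_leP qS]] := gS _ e20.
exists (p + q); split=> [t tI|].
  rewrite hornerD opprD addrACA; apply: (le_trans (ler_normD _ _)).
  by have := pf t tI; have := qg t tI; lra.
apply/op_dist_leP => x; rewrite poly_opD/= opprD addrACA.
by apply: (le_trans (nrD _ _)); have := pT x; have := qS x; lra.
Qed.

Lemma is_cfc_bounded f A T : is_cfc f A T ->
  exists2 M : R, 0 <= M & forall t, t \in `[-1, 1] -> `|f t| <= M.
Proof.
move=> fT; have [p [pf _]] := fT 1 ltr01.
have pc : {within `[-1, 1], continuous (horner p)}.
  by apply: continuous_subspaceT => t; exact: continuous_horner.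
have [M pM] := continuous_itv11_bounded pc.
have fM t : t \in `[-1, 1] -> `|f t| <= M + 1.
  move=> tI; rewrite -[f t](subrK p.[t]); apply: (le_trans (ler_normD _ _)).
  by rewrite addrC lerD ?pM// distrC pf.
exists (M + 1) => //; apply: (le_trans _ (fM 0 _)) => //.
by apply/itv11P; split; lra.
Qed.

Lemma is_cfc_le f A T (c : R) x : sa_contraction A -> is_cfc f A T ->
  (forall t, t \in `[-1, 1] -> `|f t| <= c) -> nr (T x) <= c * nr x.
Proof.
move=> sA fT fc; apply/ler_addgt0Pr => d d0.
pose e := d / (2 * nr x + 1).
have n1 : 0 < 2 * nr x + 1 by rewrite ltr_wpDl// mulr_ge0// nr_ge0.
have [p [pf /op_dist_leP pT]] := fT e (divr_gt0 d0 n1).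
have : e * (2 * nr x) <= d.
  by rewrite /e mulrAC ler_pdivrMr// ler_wpM2l ?ltW//; lra.
have := pT x; rewrite nr_sub.
have : nr (poly_op p A x) <= (c + e) * nr x.
  apply: poly_op_le => // t tI; rewrite -[p.[t]](subrK (f t)).
  by apply: (le_trans (ler_normD _ _)); have := pf _ tI; have := fc _ tI; lra.
have := nrD (T x - poly_op p A x) (poly_op p A x); rewrite subrK.
lra.
Qed.

Lemma is_cfcM f g A T S : sa_contraction A -> is_cfc f A T -> is_cfc g A S ->
  is_cfc (fun t => f t * g t) A (T \o S).
Proof.
move=> sA fT gS e e0; have [lA _ _] := sA.
have [M M0 fM] := is_cfc_bounded fT; have [N N0 gN] := is_cfc_bounded gS.
(* The errors add up to d^2 + d M + d N; with d <= 1 this is at most d (M + N + 1) <= e. *)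
pose d := Num.min 1 (e / (M + N + 1)).
have MN : 0 < M + N + 1 by lra.
have d0 : 0 < d by rewrite lt_min ltr01 divr_gt0.
have d1 : d <= 1 by rewrite ge_min lexx.
have de : d * (M + N + 1) <= e.
  by rewrite -ler_pdivlMr// ge_min lexx orbT.
have [p [pf /op_dist_leP pT]] := fT _ d0.
have [q [qg /op_dist_leP qS]] := gS _ d0.
have dd : d * d <= d by rewrite ler_piMl// ltW.
exists (p * q); split=> [t tI|].
  have -> : (p * q).[t] - f t * g t =
      (p.[t] - f t) * (q.[t] - g t) + (p.[t] - f t) * g t + f t * (q.[t] - g t).
    by rewrite hornerM; ring.
  apply: (le_trans (ler_normD _ _)).
  have h1 : `|(p.[t] - f t) * (q.[t] - g t)| <= d * d.
    by rewrite normrM ler_pM ?pf ?qg.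
  have h2 : `|(p.[t] - f t) * g t| <= d * N by rewrite normrM ler_pM ?pf ?gN.
  have h3 : `|f t * (q.[t] - g t)| <= M * d by rewrite normrM ler_pM ?fM ?qg.
  by have := ler_normD ((p.[t] - f t) * (q.[t] - g t)) ((p.[t] - f t) * g t); lra.
apply/op_dist_leP => x; rewrite poly_opM//=.
have -> : poly_op p A (poly_op q A x) - T (S x) =
    poly_op p A (poly_op q A x - S x) + (poly_op p A (S x) - T (S x)).
  by rewrite (linB _ _ (poly_op_linear p lA)) subrKA.
apply: (le_trans (nrD _ _)).
have h1 : nr (poly_op p A (poly_op q A x - S x)) <= (M + d) * (d * nr x).
  apply: (@le_trans _ _ ((M + d) * nr (poly_op q A x - S x))).
    apply: poly_op_le => // t tI; rewrite -[p.[t]](subrK (f t)).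
    by apply: (le_trans (ler_normD _ _)); have := pf _ tI; have := fM _ tI; lra.
  by rewrite ler_wpM2l//; lra.
have h2 : nr (poly_op p A (S x) - T (S x)) <= d * (N * nr x).
  apply: (le_trans (pT _)); rewrite ler_wpM2l ?(ltW d0)//.
  exact: (is_cfc_le _ sA gS gN).
apply: (@le_trans _ _ (d * (M + N + 1) * nr x)); last by rewrite ler_wpM2r ?nr_ge0.
have : d * d * nr x <= d * nr x by rewrite ler_wpM2r ?nr_ge0.
by lra.
Qed.

Lemma is_cfcZ f A T r : sa_contraction A -> is_cfc f A T ->
  is_cfc (fun t => r * f t) A (fun x => r%:C *: T x).
Proof.
move=> sA fT; have := is_cfcM sA (is_cfc_poly r%:P A) fT.
rewrite (_ : poly_op r%:P A \o T = fun x => r%:C *: T x).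
  by apply: is_cfc_ext => t _; rewrite hornerC.
by apply/funext => x /=; rewrite poly_opC.
Qed.

(** With B = A this is commutation with f(A), used for membership in the algebra. With B = -A it
    carries f(A) to f(-A) across an operator that anticommutes with A. *)
Lemma is_cfc_intertwine f A B T T' S (M : R) x : sa_contraction A ->
  sa_contraction B -> linear S -> (forall z, nr (S z) <= M * nr z) ->
  (forall z, S (A z) = B (S z)) -> is_cfc f A T -> is_cfc f B T' ->
  S (T x) = T' (S x).
Proof.
move=> sA sB lS SM SAB fT fT'; apply/eqP; rewrite -subr_eq0; apply/eqP.
have M0 : 0 <= `|M| by [].
apply: (@nr_small _ (`|M| * nr x + nr (S x))) => e e0.
have [p [pf /op_dist_leP pT]] := fT e e0.
apply: (le_trans (nr_subD (poly_op p B (S x)) _ _)).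
rewrite mulrDr lerD ?(is_cfc_approx _ sB fT' pf)//.
rewrite -(poly_op_intertwine _ _ lS SAB) -(linB _ _ lS) .
apply: (le_trans (SM _)); apply: (@le_trans _ _ (`|M| * nr (T x - poly_op p A x))).
  by rewrite ler_wpM2r ?nr_ge0// ler_norm.
by rewrite mulrCA ler_wpM2l // nr_sub.
Qed.

Lemma nr_scale (c : R[i]) x : nr (c *: x) = complex.Re `|c| * nr x.
Proof.
by apply: complexI; rewrite -normE normrZ normE [RHS]rmorphM.
Qed.

Lemma is_cfc_linear f A T : sa_contraction A -> is_cfc f A T -> linear T.
Proof.
move=> sA fT; have [lA _ _] := sA; apply: linP => [x y|c x].
  apply/eqP; rewrite -subr_eq0; apply/eqP.
  apply: (@nr_small _ (nr (x + y) + nr x + nr y)) => e e0.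
  have [p [pf /op_dist_leP pT]] := fT e e0.
  have -> : T (x + y) - (T x + T y) = (T (x + y) - poly_op p A (x + y)) +
      ((poly_op p A x - T x) + (poly_op p A y - T y)).
    by rewrite (linD _ _ (poly_op_linear p lA)) [X in _ = _ + X]addrACA -opprD subrKA.
  apply: (le_trans (nrD _ _)); rewrite nr_sub.
  have := nrD (poly_op p A x - T x) (poly_op p A y - T y).
  by have := pT (x + y); have := pT x; have := pT y; lra.
(* Homogeneity is intertwining with multiplication by c, which commutes with A. *)
symmetry; pose S x := c *: x.
apply: (@is_cfc_intertwine f A A T T S (complex.Re `|c|)) => //.
- by move=> a y z; rewrite /S scalerDr !scalerA mulrC.
- by move=> z; rewrite nr_scale.
- by move=> z; rewrite /S linZ.
Qed.

Lemma is_cfc_adjoint f A T : sa_contraction A -> is_cfc f A T -> is_adjoint T T.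
Proof.
move=> sA fT; have lT := is_cfc_linear sA fT; apply: ip_is_adjoint => // x y.
apply/eqP; rewrite -subr_eq0 -normr_le0; apply/ler_addgt0Pr => d d0.
have K0 : 0 <= 2 * (nr x * nr y) by rewrite !mulr_ge0 ?nr_ge0.
have K1 : 0 < 2 * (nr x * nr y) + 1 by lra.
have [p [pf /op_dist_leP pT]] := fT _ (divr_gt0 d0 K1).
set e := d / _ in pT.
have -> : ip (T x) y - ip x (T y) =
    ip x (poly_op p A y - T y) - ip (poly_op p A x - T x) y.
  by rewrite ipBl ipBr (poly_op_adjoint _ _ _ sA); ring.
apply: (le_trans (ler_normB _ _)); rewrite add0r.
have h1 : `|ip x (poly_op p A y - T y)| <= nr x * (e * nr y).
  by apply: (le_trans (cauchy_schwarz _ _)); rewrite ler_wpM2l ?nr_ge0.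
have h2 : `|ip (poly_op p A x - T x) y| <= e * nr x * nr y.
  by apply: (le_trans (cauchy_schwarz _ _)); rewrite ler_wpM2r ?nr_ge0.
apply: (@le_trans _ _ (e * (2 * (nr x * nr y)))); first by lra.
by rewrite /e mulrAC ler_pdivrMr// ler_wpM2l ?ltW//; lra.
Qed.

Lemma is_cfc_ge0 f A T x : sa_contraction A -> is_cfc f A T ->
  (forall t, t \in `[-1, 1] -> 0 <= f t) -> 0 <= ip (T x) x.
Proof.
move=> sA fT f0; apply/ler_addgt0Pr => d d0.
have K0 : 0 <= 2 * (nr x ^+ 2) by rewrite mulr_ge0 ?sqr_ge0.
have K1 : 0 < 2 * nr x ^+ 2 + 1 by lra.
have [p [pf /op_dist_leP pT]] := fT _ (divr_gt0 d0 K1).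
set e := d / _ in pf pT.
have h : ip (poly_op p A x - T x) x <= e * nr x ^+ 2.
  by apply: (le_trans (ip_le _ _)); rewrite expr2 mulrA ler_wpM2r ?nr_ge0.
have : 0 <= ip (poly_op (p + e%:P) A x) x.
  apply: poly_op_ge0 => // t tI; rewrite !hornerE.
  by have := pf t tI; have := f0 t tI; rewrite ler_norml => ? /andP[]; lra.
have : e * (2 * nr x ^+ 2) <= d.
  by rewrite /e mulrAC ler_pdivrMr// ler_wpM2l ?ltW//; lra.
by move: h; rewrite poly_opD poly_opC !ipDl ipNl ipZl ipxx; lra.
Qed.

Lemma is_cfc_eigen f A T v r : sa_contraction A -> r \in `[-1, 1] ->
  A v = r%:C *: v -> is_cfc f A T -> T v = (f r)%:C *: v.
Proof.
move=> sA rI Av fT; have [lA _ _] := sA.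
apply/eqP; rewrite -subr_eq0; apply/eqP.
apply: (@nr_small _ (2 * nr v)) => e e0.
have [p [pf /op_dist_leP pT]] := fT e e0.
have pv : poly_op p A v = (p.[r])%:C *: v.
  elim/poly_ind: p {pf pT} => [|p c IH]; first by rewrite poly_opC horner0.
  rewrite poly_opD poly_opMX poly_opC Av (linZ _ _ (poly_op_linear p lA)) IH.
  by rewrite !hornerE rmorphD rmorphM/= scalerDl scalerA mulrC.
apply: (le_trans (nr_subD (poly_op p A v) _ _)); rewrite nr_sub.
have : nr (poly_op p A v - (f r)%:C *: v) <= e * nr v.
  by rewrite pv -scalerBl -rmorphB/= nrZ ler_wpM2r ?nr_ge0// pf.
by have := pT v; lra.
Qed.

Lemma sa_contractionN A : sa_contraction A -> sa_contraction (fun x => - A x).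
Proof.
move=> [lA aA cA]; have lN : linear (fun x => - A x).
  by move=> c x y; rewrite lA opprD scalerN.
split=> // [|x]; last by rewrite nrN.
by apply: ip_is_adjoint => // x y; rewrite ipNl (is_adjoint_ip _ _ aA) !(ipC x) ipNl.
Qed.

Lemma is_cfc_opp f A T : sa_contraction A -> is_cfc f A T ->
  is_cfc (fun t => f (- t)) (fun x => - A x) T.
Proof.
move=> [lA _ _] fT e e0; have [p [pf pT]] := fT e e0.
exists (p \Po (- 'X)); split=> [t /itv11P tI|].
  rewrite horner_comp !hornerE; apply: pf; apply/itv11P; split; lra.
move=> x; rewrite (_ : poly_op _ _ x = poly_op p A x)//.
have lN : linear (fun x => - A x) by move=> c y z; rewrite lA opprD scalerN.
elim/poly_ind: p x {pf pT} => [|p c IH] x; first by rewrite comp_poly0 !poly_opC.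
rewrite comp_poly_MXaddC !poly_opD (poly_opM _ _ _ lN) IH poly_opMX !poly_opC.
congr (poly_op p A _ + _); rewrite -scaleN1r poly_opZ poly_opX.
by rewrite rmorphN1 scaleN1r opprK.
Qed.

End FunctionalCalculus.

(** * Sequential limits in H and the even powers of a contraction *)

Section StrongLimits.
Context {R : realType} {H : hilbertType R}.
Implicit Types (x y z u v : H) (r s t : R) (S T A B : H -> H).

Definition cvgs (a : nat -> H) l : Prop := forall e : R, 0 < e ->
  exists n, forall m, (n <= m)%N -> nr (a m - l) <= e.

Lemma cvgs_cst l : cvgs (fun=> l) l.
Proof. by move=> e e0; exists 0%N => m _; rewrite subrr nr0 ltW. Qed.

Lemma cvgsD (a b : nat -> H) k l : cvgs a k -> cvgs b l ->
  cvgs (fun n => a n + b n) (k + l).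
Proof.
move=> ak bl e e0; have e2 : 0 < e / 2 by lra.
have [n an] := ak _ e2; have [m bm] := bl _ e2.
exists (maxn n m) => i; rewrite geq_max => /andP[ni mi].
rewrite opprD addrACA; apply: (le_trans (nrD _ _)).
by have := an i ni; have := bm i mi; lra.
Qed.

Lemma cvgs_lin (a : nat -> H) l T (M : R) : linear T ->
  (forall x, nr (T x) <= M * nr x) -> cvgs a l -> cvgs (fun n => T (a n)) (T l).
Proof.
move=> lT TM al e e0; have M1 : 0 < `|M| + 1 by have := normr_ge0 M; lra.
have [n an] := al _ (divr_gt0 e0 M1); exists n => m /an {}an.
rewrite -linB//; apply: (le_trans (TM _)).
apply: (@le_trans _ _ ((`|M| + 1) * nr (a m - l))).
  by rewrite ler_wpM2r ?nr_ge0//; have := ler_norm M; lra.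
by rewrite mulrC -ler_pdivlMr.
Qed.

Lemma cvgsN (a : nat -> H) l : cvgs a l -> cvgs (fun n => - a n) (- l).
Proof.
apply: (@cvgs_lin _ _ (fun x => - x) 1) => [c x y|x]; last by rewrite nrN mul1r.
by rewrite opprD scalerN.
Qed.

Lemma cvgs_shift (a b : nat -> H) l : (forall n, b n = a n.+1) -> cvgs a l -> cvgs b l.
Proof.
move=> ba al e /al[n an]; exists n => m nm.
by rewrite ba; apply: an; exact: leqW.
Qed.

Lemma cvgs_nr_le (a : nat -> H) l (c : R) : cvgs a l ->
  (forall n, nr (a n) <= c) -> nr l <= c.
Proof.
move=> al ac; apply/ler_addgt0Pr => e /al[n /(_ n (leqnn n)) an].
have := nr_subD (a n) l 0; rewrite !subr0 => h; apply: (le_trans h).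
by rewrite nr_sub addrC lerD.
Qed.

Lemma cvgs_unique (a : nat -> H) k l : cvgs a k -> cvgs a l -> k = l.
Proof.
move=> ak al; apply/eqP; rewrite -subr_eq0; apply/eqP/nr_eq0/le_anti.
rewrite nr_ge0 andbT; apply: (cvgs_nr_le (cvgsD ak (cvgsN al))) => n.
by rewrite subrr nr0.
Qed.

Lemma cvgs_ip_ge (a : nat -> H) l x (c : R) (n0 : nat) : cvgs a l ->
  (forall n, (n0 <= n)%N -> c <= ip (a n) x) -> c <= ip l x.
Proof.
move=> al ac; apply/ler_addgt0Pr => e e0.
have x1 : 0 < nr x + 1 by have := nr_ge0 x; lra.
have [n an] := al _ (divr_gt0 e0 x1).
have := an (maxn n n0) (leq_maxl _ _); have := ac (maxn n n0) (leq_maxr _ _).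
set b := a _ => cb bl.
have := ip_le (b - l) x; rewrite ipBl.
have : nr (b - l) * nr x <= e.
  apply: (le_trans (ler_wpM2r (nr_ge0 x) bl)).
  by rewrite mulrAC ler_pdivrMr// ler_wpM2l ?(ltW e0)//; lra.
lra.
Qed.

Lemma cvgs_ip (a b : nat -> H) k l x y : cvgs a k -> cvgs b l ->
  (forall n, ip (a n) x = ip (b n) y) -> ip k x = ip l y.
Proof.
move=> ak bl ab.
have half (a' b' : nat -> H) k' l' x' y' : cvgs a' k' -> cvgs b' l' ->
    (forall n, ip (a' n) x' = ip (b' n) y') -> ip l' y' <= ip k' x'.
  move=> ak' bl' ab'; rewrite -lerN2 -ipNl; apply/ler_addgt0Pr => e e0.
  have e20 : 0 < e / 2 by lra.
  have y1 : 0 < nr y' + 1 by have := nr_ge0 y'; lra.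
  have [n bn] := bl' _ (divr_gt0 e20 y1).
  have near m : (n <= m)%N -> ip l' y' - e / 2 <= ip (a' m) x'.
    move=> /bn bm; rewrite ab'.
    have := ip_le (l' - b' m) y'; rewrite ipBl nr_sub.
    have : nr (b' m - l') * nr y' <= e / 2.
      apply: (le_trans (ler_wpM2r (nr_ge0 y') bm)).
      by rewrite mulrAC ler_pdivrMr// ler_wpM2l ?(ltW e20)//; lra.
    lra.
  by have := cvgs_ip_ge ak' near; rewrite ipNl; lra.
apply/le_anti/andP; split; first by apply: half bl ak _ => n; rewrite ab.
exact: half ak bl ab.
Qed.

Lemma iter_linear n A : linear A -> linear (iter n A).
Proof. by move=> lA c x y; elim: n => //= n ->; rewrite lA. Qed.

Lemma iter_nr_le n A x : (forall z, nr (A z) <= nr z) -> nr (iter n A x) <= nr x.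
Proof. by move=> cA; elim: n => //= n; exact/le_trans/cA. Qed.

Lemma iter_ip n A x y : is_adjoint A A -> ip (iter n A x) y = ip x (iter n A y).
Proof.
move=> aA; elim: n y => //= n IH y.
by rewrite (is_adjoint_ip _ _ aA) IH -iterSr.
Qed.

(* |A^2n x - A^2m x|^2 = a (2n) - 2 a (n + m) + a (2m) with a k = |A^k x|^2
   decreasing. *)
Lemma even_powers_cvg A : sa_contraction A ->
  exists E : H -> H, forall x, cvgs (fun n => iter n.*2 A x) (E x).
Proof.
move=> [lA aA cA].
suff /choice[E EP] : forall x, exists l, cvgs (fun n => iter n.*2 A x) l by exists E.
move=> x; apply: hilbert_complete => e e0.
pose a k := nr (iter k A x) ^+ 2.
have a_dec n m : (n <= m)%N -> a m <= a n.
  move=> /subnKC <-; rewrite /a addnC iterD.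
  by rewrite lerXn2r ?nnegrE ?nr_ge0// iter_nr_le.
have hi : has_inf (range a).
  by split; [exists (a 0%N), 0%N|exists 0 => _ [k _ <-]; exact: sqr_ge0].
have e20 : 0 < e ^+ 2 / 2 by rewrite divr_gt0 ?exprn_gt0.
(* From this n on, a (2n) and a (2m) each exceed the infimum by at most e^2 / 2, while a (n + m) is
   at least the infimum. The squared distance is thus at most e^2. *)
have [_ [n _ <-] an] := inf_adherent e20 hi.
have inf_le k : inf (range a) <= a k.
  by apply: ge_inf; [exact: hi.2|exists k].
exists n => m nm.
rewrite -ler_sqr ?nnegrE ?nr_ge0 ?(ltW e0)// -ipxx ipBl !ipBr.
have ipa i j : ip (iter i.*2 A x) (iter j.*2 A x) = a (i + j)%N.
  by rewrite /a -ipxx !iter_ip// -!iterD; congr (ip x (iter _ A x)); lia.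
have h1 := a_dec n (n + n)%N (leq_addl _ _).
have h2 := a_dec n (m + m)%N (leq_trans nm (leq_addl _ _)).
have h3 := inf_le (n + m)%N.
by rewrite !ipa [(m + n)%N]addnC; lra.
Qed.

End StrongLimits.

(** * Positive operators and uniqueness of the positive square root *)

Section SquareRoots.
Context {R : realType} {H : hilbertType R}.
Implicit Types (x y z u v : H) (r s t : R) (S T A B M G : H -> H).

Lemma bounded_opP T : bounded_op T <->
  linear T /\ exists2 c : R, 0 < c & forall x, nr (T x) <= c * nr x.
Proof.
split=> [[lT [c Tc]]|[lT [c _ Tc]]]; split=> //; last first.
  by exists c => x; rewrite le_opnorm.
exists (`|c| + 1) => [|x]; first by have := normr_ge0 c; lra.
have := Tc x; rewrite le_opnorm => h; apply: (le_trans h).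
by rewrite ler_wpM2r ?nr_ge0//; have := ler_norm c; lra.
Qed.

Lemma ip_i x y : ip ('i%C *: x) ('i%C *: y) = ip x y.
Proof.
by rewrite /ip linearZl_LR linearZr_LR/=; case: '[x, y] => a b /=; ring.
Qed.

(** Polarization: the form of T is real at every vector, in particular at x + i y, and the cross
    terms there compare T on the two sides. *)
Lemma positive_op_adjoint T : positive_op T -> is_adjoint T T.
Proof.
move=> [/bounded_opP[lT _] T0]; have Im0 x : ip (T x) ('i%C *: x) = 0.
  rewrite -Im_hdot; have := T0 x; rewrite linear0l lecE => /andP[/eqP-> _].
  by [].
apply: ip_is_adjoint => // x y; rewrite (ipC x).
have := Im0 (x + 'i%C *: y); rewrite linD// linZ// scalerDr scalerA.
have -> : 'i%C * 'i%C = -1 :> R[i] by rewrite -expr2 sqr_i.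
rewrite scaleN1r ipDl !ipDr ip_i Im0 ![ip _ (- y)]ipC !ipNl ![ip y _]ipC.
have -> : ip ('i%C *: T y) y = - ip (T y) ('i%C *: y).
  by rewrite -ip_i scalerA -expr2 sqr_i scaleN1r ipNl.
rewrite Im0; lra.
Qed.

Lemma positive_op_ip T x : positive_op T -> 0 <= ip (T x) x.
Proof.
by move=> [_ /(_ x)]; rewrite linear0l lecE => /andP[].
Qed.

Lemma ip_positive_op T : bounded_op T -> is_adjoint T T ->
  (forall x, 0 <= ip (T x) x) -> positive_op T.
Proof.
move=> bT aT T0; split=> // x; rewrite linear0l lecE selfadjoint_Im// eqxx.
exact: T0.
Qed.

(** Along y - s T y the form of T is -2 s p + s^2 K with p = |T y|^2. It would be negative for small
    s > 0 if p were positive. *)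
Lemma positive_op_null T y : positive_op T -> ip (T y) y = 0 -> T y = 0.
Proof.
move=> pT Ty; have aT := positive_op_adjoint pT; have [/bounded_opP[lT _] _] := pT.
apply/nr_eq0/eqP; rewrite -sqrf_eq0; apply/eqP.
set p := _ ^+ 2; have p0 : 0 <= p by exact: sqr_ge0.
pose K := ip (T (T y)) (T y); have K0 : 0 <= K by exact: positive_op_ip.
have quad s : 0 <= - 2 * s * p + s ^+ 2 * K.
  have := positive_op_ip (y - s%:C *: T y) pT.
  rewrite linB// linZ// ipBl !ipBr !ipZl !ipZr Ty.
  rewrite [ip (T (T y)) y](is_adjoint_ip _ _ aT).
  by rewrite !ipxx -/p -/K; lra.
(* K + 1 instead of the minimizing K keeps the denominator positive when K = 0. *)
have := quad (p / (K + 1)).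
have -> : - 2 * (p / (K + 1)) * p + (p / (K + 1)) ^+ 2 * K =
   - (p / (K + 1)) * (p / (K + 1)) * (K + 2) by field; lra.
rewrite mulNr mulNr oppr_ge0 => h; apply/eqP; move: h; rewrite -expr2.
apply: contraLR => pn0; rewrite -ltNge mulr_gt0//; last by lra.
by rewrite exprn_even_gt0//= mulf_neq0// invr_eq0 gt_eqF//; lra.
Qed.

(** For y = (S - T) x, commutation gives (S + T) y = 0. The forms of S and T at y are nonnegative
    and opposite, so S y = T y = 0, and |y|^2 is the product of x with (S - T) y = 0. *)
Lemma commuting_sqrt_unique S T : positive_op S -> positive_op T ->
  (forall x, S (T x) = T (S x)) -> (forall x, S (S x) = T (T x)) -> S = T.
Proof.
move=> pS pT ST SS; apply/funext => x.
have aS := positive_op_adjoint pS; have aT := positive_op_adjoint pT.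
have [/bounded_opP[lS _] _] := pS; have [/bounded_opP[lT _] _] := pT.
pose y := S x - T x; have SyTy : S y = - T y.
  by rewrite /y (linB _ _ lS) (linB _ _ lT) SS ST opprB.
have Sy0 : S y = 0.
  apply: positive_op_null => //; apply/le_anti; rewrite positive_op_ip// andbT.
  by rewrite SyTy ipNl oppr_le0 positive_op_ip.
have Ty0 : T y = 0 by rewrite -[T y]opprK -SyTy Sy0 oppr0.
apply/eqP; rewrite -subr_eq0; apply/eqP/nr_eq0/eqP; rewrite -sqrf_eq0 -ipxx -/y.
by rewrite {1}/y ipBl (is_adjoint_ip _ _ aS) (is_adjoint_ip _ _ aT) Sy0 Ty0 subrr.
Qed.

Lemma cont_sqrt_half_add1 :
  {within `[-1, 1], continuous (fun t : R => Num.sqrt ((1 + t) / 2))}.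
Proof.
apply: continuous_subspaceT => t; apply: continuous_comp; last exact: sqrt_continuous.
by apply: cvgM; [apply: cvgD; [exact: cvg_cst|exact: cvg_id]|exact: cvg_cst].
Qed.

(* The root is taken by functional calculus at 2 T^2 / c - 1, a contraction
   since 0 <= T^2 <= c, so that it commutes with everything T^2 commutes with. *)
Lemma commutant_sqrt T : positive_op T -> exists2 G, positive_op G &
  (forall x, G (G x) = T (T x)) /\
  forall S, bounded_op S -> (forall x, S (T (T x)) = T (T (S x))) ->
    forall x, S (G x) = G (S x).
Proof.
move=> pT; have aT := positive_op_adjoint pT.
have [/bounded_opP[lT [d d0 Td]] _] := pT.
pose c := d ^+ 2; have c0 : 0 < c by rewrite exprn_gt0.
have TTip x y : ip (T (T x)) y = ip (T x) (T y) by rewrite (is_adjoint_ip _ _ aT).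
pose A x := (2 / c)%:C *: T (T x) - x.
have lA : linear A.
  move=> a x y; rewrite /A !lT scalerDr scalerA mulrC -scalerA.
  by rewrite opprD addrACA scalerBr.
have aA : is_adjoint A A.
  apply: ip_is_adjoint => // x y.
  by rewrite /A ipBl ipBr ipZl ipZr TTip ![ip x _]ipC TTip (ipC (T x)).
have cA x : nr (A x) <= nr x.
  rewrite -ler_sqr ?nnegrE ?nr_ge0// -ipxx /A ipBl !ipBr !ipZl !ipZr.
  rewrite (ipC x) !(TTip x x) !ipxx -subr_ge0.
  have : nr (T (T x)) ^+ 2 <= c * nr (T x) ^+ 2.
    by rewrite /c -exprMn lerXn2r ?nnegrE ?mulr_ge0 ?nr_ge0// ltW.
  rewrite -subr_ge0 => h.
  rewrite [X in 0 <= X](_ : _ =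
    (2 / c) ^+ 2 * (c * nr (T x) ^+ 2 - nr (T (T x)) ^+ 2)).
    by rewrite mulr_ge0// sqr_ge0.
  by field; lra.
have sA : sa_contraction A by [].
(* (1 + t) / 2 inverts the affine change of variable: at A it is T^2 / c. Hence the final factor
   [Num.sqrt c]. *)
pose g t : R := Num.sqrt ((1 + t) / 2).
have gG := cfcP sA cont_sqrt_half_add1; rewrite -/g in gG; set G := cfc g A in gG.
have gg : is_cfc (horner (2^-1 *: (1 + 'X))) A (G \o G).
  apply: is_cfc_ext (is_cfcM sA gG gG) => t /itv11P tI.
  by rewrite !hornerE /g -expr2 sqr_sqrtr; [ring|lra].
have GG x : G (G x) = (c^-1)%:C *: T (T x).
  have := is_cfc_unique sA gg (@is_cfc_poly _ _ _ A) => /(congr1 (@^~ x)) /= ->.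
  rewrite poly_opZ poly_opD poly_op1 poly_opX /A addrC subrK scalerA -rmorphM.
  by congr (_%:C *: _); field; lra.
have lG := is_cfc_linear sA gG; have aG := is_cfc_adjoint sA gG.
exists (fun x => (Num.sqrt c)%:C *: G x).
  apply: ip_positive_op.
  - apply/bounded_opP; split.
      by move=> a x y; rewrite lG scalerDr !scalerA mulrC.
    have [m m0 gm] := is_cfc_bounded gG.
    exists (Num.sqrt c * (m + 1)) => [|x]; first by rewrite mulr_gt0 ?sqrtr_gt0//; lra.
    rewrite nrZ ger0_norm ?sqrtr_ge0// -mulrA ler_wpM2l ?sqrtr_ge0//.
    apply: (is_cfc_le _ sA gG) => t /gm; lra.
  - apply: ip_is_adjoint => [a x y|x y].
      by rewrite lG scalerDr !scalerA mulrC.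
    by rewrite ipZl ipZr (is_adjoint_ip _ _ aG).
  - move=> x; rewrite ipZl mulr_ge0 ?sqrtr_ge0//.
    by apply: (is_cfc_ge0 _ sA gG) => t _; exact: sqrtr_ge0.
split=> [x|S /bounded_opP[lS [m _ Sm]] ST x].
  rewrite (linZ _ _ lG) GG !scalerA -!rmorphM/= [X in X%:C](_ : _ = 1) ?scale1r//.
  have cc : Num.sqrt c * Num.sqrt c = c by rewrite -expr2 sqr_sqrtr ?(ltW c0).
  by rewrite mulrA cc divff// gt_eqF.
rewrite (linZ _ _ lS); congr (_ *: _).
apply: (is_cfc_intertwine _ sA sA lS Sm _ gG gG) => z.
by rewrite /A (linB _ _ lS) (linZ _ _ lS) ST.
Qed.

(** S and T need not commute a priori. Each commutes with its own square, which is the common one,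
    hence with the root G; both therefore equal G. *)
Lemma sqrt_unique S T : positive_op S -> positive_op T -> S \o S = T \o T -> S = T.
Proof.
move=> pS pT SSTT; have SS x : S (S x) = T (T x) by have /(congr1 (@^~ x)) := SSTT.
have [G pG [GG comm]] := commutant_sqrt pT.
have -> : T = G.
  by apply: commuting_sqrt_unique => // x; rewrite comm//; exact: pT.1.
apply: commuting_sqrt_unique => // [x|x]; last by rewrite SS GG.
by rewrite comm => [//||z]; [exact: pS.1|rewrite -!SS].
Qed.

End SquareRoots.

(** * Projections onto the eigenspaces for 1 and -1 *)

Section EigenProjections.
Context {R : realType} {H : hilbertType R}.
Implicit Types (x y z u v : H) (r s t : R) (S T A B E : H -> H).

Lemma cvgs_ip_le (a : nat -> H) l x (c : R) : cvgs a l ->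
  (forall n, ip (a n) x <= c) -> ip l x <= c.
Proof.
move=> al ac; rewrite -lerN2 -ipNl.
by apply: (cvgs_ip_ge (n0 := 0%N) (cvgsN al)) => n _; rewrite ipNl lerN2.
Qed.

Definition even_limit A E : Prop := forall x, cvgs (fun n => iter n.*2 A x) (E x).

Section EvenLimit.
Variables (A E : H -> H).
Hypotheses (sA : sa_contraction A) (AE : even_limit A E).
Let lA : linear A. Proof. by case: sA. Qed.
Let aA : is_adjoint A A. Proof. by case: sA. Qed.
Let cA x : nr (A x) <= nr x. Proof. by case: sA. Qed.

Lemma even_limit_comm S (M : R) x : linear S -> (forall z, nr (S z) <= M * nr z) ->
  (forall z, S (A z) = A (S z)) -> S (E x) = E (S x).
Proof.
move=> lS SM SA; apply: cvgs_unique (cvgs_lin lS SM (AE x)) _.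
rewrite (_ : (fun n => _) = fun n => iter n.*2 A (S x)); first exact: AE.
by apply/funext => n; elim: n.*2 => //= k IH; rewrite SA IH.
Qed.

Lemma even_limit_linear : linear E.
Proof.
apply: linP => [x y|c x]; last first.
  symmetry.
  apply: (@even_limit_comm (fun z => c *: z) (complex.Re `|c|)) => [a y z|z|z].
  - by rewrite scalerDr !scalerA mulrC.
  - by rewrite nr_scale.
  - by rewrite linZ.
apply: cvgs_unique (AE (x + y)) _.
rewrite (_ : (fun n => _) = fun n => iter n.*2 A x + iter n.*2 A y).
  exact: cvgsD.
by apply/funext => n; rewrite (linD _ _ (iter_linear _ lA)).
Qed.

Lemma even_limit_le x : nr (E x) <= nr x.
Proof. by apply: cvgs_nr_le (AE x) _ => n; exact: iter_nr_le. Qed.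

Lemma even_limit_ip x y : ip (E x) y = ip x (E y).
Proof.
rewrite (ipC x); apply: cvgs_ip (AE x) (AE y) _ => n.
by rewrite iter_ip// ipC.
Qed.

Lemma even_limit_fix x : A (A (E x)) = E x.
Proof.
have h : cvgs (fun n => (A \o A) (iter n.*2 A x)) (A (A (E x))).
  apply: (@cvgs_lin _ _ _ _ (A \o A) 1) => [|z|]; last exact: AE.
    exact: lin_comp.
  by rewrite mul1r; apply: le_trans (cA _) _.
by apply: cvgs_unique h (cvgs_shift _ (AE x)) => n.
Qed.

Lemma even_limit_id v : A (A v) = v -> E v = v.
Proof.
move=> Av; apply: cvgs_unique (AE v) _.
rewrite (_ : (fun n => _) = fun=> v); first exact: cvgs_cst.
by apply/funext => n; elim: n => //= n ->.
Qed.

(** E projects onto the vectors fixed by A^2, where A is an involution; for r = 1 or -1, (1 + r A) /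
    2 is there the projection onto the eigenspace of r. *)
Definition eigenproj r x : H := 2^-1%:C *: (E x + r%:C *: A (E x)).

Lemma eigenproj_linear r : linear (eigenproj r).
Proof.
move=> c x y; rewrite /eigenproj even_limit_linear lA !scalerDr !scalerA.
rewrite addrACA; congr (_ + _ + (_ + _)); congr (_ *: _); ring.
Qed.

Lemma eigenproj_ip r x y : ip (eigenproj r x) y = ip x (eigenproj r y).
Proof.
rewrite /eigenproj ipZl ipZr ipDl ipDr ipZl ipZr even_limit_ip.
rewrite (is_adjoint_ip _ _ aA) even_limit_ip.
by rewrite (@even_limit_comm A 1)// => z; rewrite mul1r.
Qed.

Lemma eigenproj_le r x : nr (eigenproj r x) <= (1 + `|r|) * nr x.
Proof.
rewrite /eigenproj nrZ ger0_norm ?invr_ge0//.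
have := nrD (E x) (r%:C *: A (E x)); rewrite nrZ => h.
have h2 : nr (A (E x)) <= nr x := le_trans (cA _) (even_limit_le x).
have := ler_wpM2l (normr_ge0 r) h2; have := even_limit_le x.
have := mulr_ge0 (normr_ge0 r) (nr_ge0 x); have := nr_ge0 x; lra.
Qed.

Lemma eigenproj_eigen r x : r ^+ 2 = 1 -> A (eigenproj r x) = r%:C *: eigenproj r x.
Proof.
move=> r1; rewrite /eigenproj (linZ _ _ lA) (linD _ _ lA) (linZ _ _ lA).
rewrite even_limit_fix scalerA mulrC -scalerA; congr (_ *: _).
by rewrite scalerDr scalerA -rmorphM/= -expr2 r1 scale1r addrC.
Qed.

Lemma eigenproj_id r v : r ^+ 2 = 1 -> A v = r%:C *: v -> eigenproj r v = v.
Proof.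
move=> r1 Av; have AAv : A (A v) = v.
  by rewrite Av (linZ _ _ lA) Av scalerA -rmorphM/= -expr2 r1 scale1r.
rewrite /eigenproj even_limit_id// Av scalerA -rmorphM/= -expr2 r1 scale1r.
rewrite -{1 2}[v]scale1r -scalerDl scalerA -[RHS]scale1r; congr (_ *: _).
by apply/eqP; rewrite eq_complex/=; apply/andP; split; apply/eqP; field.
Qed.

Lemma eigenprojD x : eigenproj 1 x + eigenproj (-1) x = E x.
Proof.
rewrite /eigenproj rmorphN1 scale1r scaleN1r -scalerDr addrACA subrr addr0.
rewrite -{1 2}[E x]scale1r -scalerDl scalerA -[RHS]scale1r; congr (_ *: _).
by apply/eqP; rewrite eq_complex/=; apply/andP; split; apply/eqP; field.
Qed.

Lemma eigenproj_comm r S (M : R) x : linear S -> (forall z, nr (S z) <= M * nr z) ->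
  (forall z, S (A z) = A (S z)) -> S (eigenproj r x) = eigenproj r (S x).
Proof.
move=> lS SM SA; rewrite /eigenproj (linZ _ _ lS) (linD _ _ lS) (linZ _ _ lS) SA.
by rewrite (even_limit_comm _ lS SM SA).
Qed.

Lemma eigenproj_bounded r : bounded_op (eigenproj r).
Proof.
apply/bounded_opP; split; first exact: eigenproj_linear.
exists (1 + `|r|) => [|x]; last exact: eigenproj_le.
by have := normr_ge0 r; lra.
Qed.

Lemma eigenproj_positive r : r ^+ 2 = 1 -> positive_op (eigenproj r).
Proof.
move=> r1; apply: ip_positive_op; first exact: eigenproj_bounded.
  by apply: ip_is_adjoint; [exact: eigenproj_linear|exact: eigenproj_ip].
move=> x; rewrite -[eigenproj r x](@eigenproj_id r)//; last exact: eigenproj_eigen.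
by rewrite eigenproj_ip ipxx sqr_ge0.
Qed.

Lemma proj_eigenproj r : r ^+ 2 = 1 ->
  Defs.proj [set v | A v = r%:C *: v] = eigenproj r.
Proof.
move=> r1; have ap : is_adjoint (eigenproj r) (eigenproj r).
  by apply: ip_is_adjoint; [exact: eigenproj_linear|exact: eigenproj_ip].
apply/funext => x; apply: xget_unique.
  split=> [/=|v Av]; first exact: eigenproj_eigen.
  by rewrite linearBl/= ap eigenproj_id// subrr.
(* d lies in the eigenspace and, as a difference of two vectors orthogonal to it, is also orthogonal
   to it. *)
move=> y [/= Ay xy]; pose d := y - eigenproj r x.
have Ad : A d = r%:C *: d by rewrite /d (linB _ _ lA) Ay eigenproj_eigen// scalerBr.
have pd : '[x - eigenproj r x, d] = 0 by rewrite linearBl/= ap eigenproj_id// subrr.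
have dE : d = (x - eigenproj r x) - (x - y) by rewrite opprB [RHS]addrC subrKA.
apply/eqP; rewrite -subr_eq0 -/d; apply/eqP/nr_eq0/eqP.
by rewrite -sqrf_eq0 -ipxx {1}dE /ip linearBl/= pd xy// subr0.
Qed.

End EvenLimit.
End EigenProjections.

(** * Membership in the algebra, its positive cone, and the trace *)

Section Trace.
Context {R : realType} {H : hilbertType R}.
Implicit Types (x y z u v : H) (r s t : R) (S T A B X Y : H -> H).
Variables (N : set (H -> H)) (tau : (H -> H) -> \bar R).
Hypotheses (hN : von_neumann_algebra N) (htau : faithful_normal_semifinite_trace N tau).

Lemma vN_bounded T : N T -> bounded_op T.
Proof. by rewrite -hN.2 => -[]. Qed.

(** The bicommutant form of membership. Commutation with a bounded S survives sums, functional
    calculus and strong limits, so no topology on N is needed. *)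
Lemma vN_mem T : bounded_op T ->
  (forall S, bounded_op S -> (forall B, N B -> forall x, S (B x) = B (S x)) ->
    forall x, S (T x) = T (S x)) -> N T.
Proof.
move=> bT comm; rewrite -hN.2; split=> // S [bS SN].
apply/funext => x /=; rewrite comm// => B NB y.
by have /(congr1 (@^~ y)) := SN B NB.
Qed.

Lemma pos_cone_mem T : N T -> is_adjoint T T -> (forall x, 0 <= ip (T x) x) ->
  pos_cone N T.
Proof.
by move=> NT aT T0; split=> //; apply: ip_positive_op => //; exact: vN_bounded.
Qed.

Lemma pos_coneD A B : pos_cone N A -> pos_cone N B -> pos_cone N (A \+ B).
Proof.
move=> [NA pA] [NB pB]; have aA := positive_op_adjoint pA.
have aB := positive_op_adjoint pB.
have [/bounded_opP[lA [c c0 Ac]] _] := pA; have [/bounded_opP[lB [d d0 Bd]] _] := pB.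
have lAB : linear (A \+ B) by move=> a x y /=; rewrite lA lB scalerDr addrACA.
have bAB : bounded_op (A \+ B).
  apply/bounded_opP; split=> //; exists (c + d) => [|x /=]; first by lra.
  by apply: (le_trans (nrD _ _)); have := Ac x; have := Bd x; lra.
apply: pos_cone_mem.
- apply: vN_mem => // S [lS _] SN x /=.
  by rewrite (linD _ _ lS) SN// SN.
- apply: ip_is_adjoint => // x y /=.
  by rewrite ipDl ipDr (is_adjoint_ip _ _ aA) (is_adjoint_ip _ _ aB).
- by move=> x /=; rewrite ipDl addr_ge0// positive_op_ip.
Qed.

Lemma pos_coneZ r A : 0 <= r -> pos_cone N A -> pos_cone N (fun x => r%:C *: A x).
Proof.
move=> r0 [NA pA]; have aA := positive_op_adjoint pA.
have [/bounded_opP[lA [c c0 Ac]] _] := pA.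
have lrA : linear (fun x => r%:C *: A x).
  by move=> a x y /=; rewrite lA scalerDr !scalerA mulrC.
have brA : bounded_op (fun x => r%:C *: A x).
  apply/bounded_opP; split=> //; exists (r * c + 1) => [|x /=].
    by have := mulr_ge0 r0 (ltW c0); lra.
  rewrite nrZ ger0_norm//; have := ler_wpM2l r0 (Ac x); have := nr_ge0 x; lra.
apply: pos_cone_mem.
- by apply: vN_mem => // S [lS _] SN x; rewrite (linZ _ _ lS) SN.
- by apply: ip_is_adjoint => // x y; rewrite ipZl ipZr (is_adjoint_ip _ _ aA).
- by move=> x; rewrite ipZl mulr_ge0// positive_op_ip.
Qed.

Lemma trace_sum_fin A B : pos_cone N A -> pos_cone N B ->
  (tau (A \+ B)%R < +oo)%E -> (tau A < +oo)%E /\ (tau B < +oo)%E.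
Proof.
move=> pA pB; rewrite (traceD htau)// => AB; split; apply: le_lt_trans AB.
  by rewrite leeDl// (trace_ge0 htau).
by rewrite leeDr// (trace_ge0 htau).
Qed.

Lemma trace_fin_num A : pos_cone N A -> (tau A < +oo)%E -> tau A \is a fin_num.
Proof. by move=> pA A_oo; rewrite ge0_fin_numE// (trace_ge0 htau). Qed.

(** Independence of the decomposition: A - B = A' - B' is the identity A + B' = A' + B between
    positive operators, where [tau] is additive. *)
Lemma trace_saE A B : pos_cone N A -> (tau A < +oo)%E -> pos_cone N B ->
  (tau B < +oo)%E -> trace_sa N tau (A \- B) = fine (tau A) - fine (tau B).
Proof.
move=> pA fA pB fB; apply: xget_unique; first by exists A, B.
move=> r [A' [B' [[pA' fA'] [pB' fB'] AB ->]]].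
have sumE : A \+ B' = A' \+ B.
  apply/funext => x; have /(congr1 (@^~ x)) /= AB' := AB.
  have -> : A x = (A' x - B' x) + B x by rewrite -AB' subrK.
  by rewrite addrAC subrK.
have : (tau A + tau B' = tau A' + tau B)%E by rewrite -!(traceD htau)// sumE.
rewrite -(fineK (trace_fin_num pA fA)) -(fineK (trace_fin_num pB fB)).
rewrite -(fineK (trace_fin_num pA' fA')) -(fineK (trace_fin_num pB' fB')).
by rewrite -!EFinD => -[] /=; lra.
Qed.

(** Normality is given for directed sets and least upper bounds; the strong limit of an increasing
    sequence is such a bound. *)
Lemma trace_sup (X_ : nat -> H -> H) X : (forall n, pos_cone N (X_ n)) ->
  (forall n m x, (n <= m)%N -> ip (X_ n x) x <= ip (X_ m x) x) ->
  pos_cone N X -> (forall x, cvgs (X_ ^~ x) (X x)) ->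
  tau X = ereal_sup (range (tau \o X_)).
Proof.
move=> pX_ X_inc pX X_X.
have aX_ n : is_adjoint (X_ n) (X_ n) by exact: positive_op_adjoint (pX_ n).2.
have aX : is_adjoint X X by exact: positive_op_adjoint pX.2.
have le_X n m : (n <= m)%N -> op_le (X_ n) (X_ m).
  by move=> nm; apply/selfadjoint_op_le => // x; exact: X_inc.
rewrite (trace_normal htau (D := range X_))//.
- by rewrite image_comp.
- by move=> _ [n _ <-].
- split; first by exists (X_ 0%N), 0%N.
  move=> _ _ [n _ <-] [m _ <-]; exists (X_ (maxn n m)).
  by split; [exists (maxn n m)|apply: le_X; exact: leq_maxl
            |apply: le_X; exact: leq_maxr].
- split=> [_ [n _ <-]|S NS XS].
    apply/selfadjoint_op_le => // x.
    by apply: (cvgs_ip_ge (n0 := n) (X_X x)) => m nm; exact: X_inc.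
  move=> x; have XnS n : op_le (X_ n) S by apply: XS; exists n.
  (* The order of R[i] also compares imaginary parts, and the upper bound S is an arbitrary element
     of N. Its form is real because it dominates that of the self-adjoint [X_ 0]. *)
  rewrite lecE; apply/andP; split; last first.
    by apply: cvgs_ip_le (X_X x) _ => n; exact: ip_op_le.
  rewrite (selfadjoint_Im _ aX).
  by have := XnS 0%N x; rewrite lecE (selfadjoint_Im _ (aX_ 0%N)) => /andP[].
Qed.

End Trace.

(** * Continuity of pointwise operations on [-1, 1] *)

Section Continuity.
Context {R : realType}.
Implicit Types (f g : R -> R).

Lemma cont_mul f g : {within `[-1, 1], continuous f} ->
  {within `[-1, 1], continuous g} -> {within `[-1, 1], continuous (fun t => f t * g t)}.
Proof. by move=> fc gc x; exact: (continuousM (fc x) (gc x)). Qed.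

Lemma cont_add f g : {within `[-1, 1], continuous f} ->
  {within `[-1, 1], continuous g} -> {within `[-1, 1], continuous (fun t => f t + g t)}.
Proof. by move=> fc gc x; exact: (continuousD (fc x) (gc x)). Qed.

Lemma cont_horner (p : {poly R}) : {within `[-1, 1], continuous (horner p)}.
Proof. by apply: continuous_subspaceT => t; exact: continuous_horner. Qed.

Lemma cont_comp f g : continuous g ->
  {within `[-1, 1], continuous f} -> {within `[-1, 1], continuous (g \o f)}.
Proof. by move=> gc fc x; exact: (continuous_comp (fc x) (gc _)). Qed.

End Continuity.

(** * The pair A = P - Q, B = 1 - P - Q and the traces of functions of A *)

Section ProjectionPair.
Context {R : realType} {H : hilbertType R}.
Implicit Types (x y z u v : H) (r s t : R) (S T X Y E : H -> H) (f g h : R -> R).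
Variables (N : set (H -> H)) (tau : (H -> H) -> \bar R) (P Q : H -> H).
Hypotheses (hN : von_neumann_algebra N) (htau : faithful_normal_semifinite_trace N tau).
Hypotheses (hP : N P) (hPp : is_projection P) (hQ : N Q) (hQp : is_projection Q).

Let A : H -> H := P \- Q.
Let B : H -> H := fun x => x - P x - Q x.

Let lP : linear P. Proof. by case: (vN_bounded hN hP). Qed.
Let lQ : linear Q. Proof. by case: (vN_bounded hN hQ). Qed.
Let PP x : P (P x) = P x. Proof. by have /(congr1 (@^~ x)) := hPp.1. Qed.
Let QQ x : Q (Q x) = Q x. Proof. by have /(congr1 (@^~ x)) := hQp.1. Qed.
Let ipP x y : ip (P x) y = ip x (P y). Proof. exact: is_adjoint_ip hPp.2. Qed.
Let ipQ x y : ip (Q x) y = ip x (Q y). Proof. exact: is_adjoint_ip hQp.2. Qed.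

Lemma pair_linear : linear A /\ linear B.
Proof.
split=> c x y; apply: ip_inj => z.
  by rewrite /A/= lP lQ scalerBr !(ipDl, ipNl); ring.
by rewrite /B lP lQ !scalerBr !(ipDl, ipNl); ring.
Qed.
Let lA : linear A := pair_linear.1.
Let lB : linear B := pair_linear.2.

Lemma pair_adjoint : is_adjoint A A /\ is_adjoint B B.
Proof.
split; apply: ip_is_adjoint => // x y; rewrite /A /B/=.
  by rewrite ipBl ipBr ipP ipQ.
by rewrite !ipBl !ipBr ipP ipQ.
Qed.
Let aA : is_adjoint A A := pair_adjoint.1.
Let aB : is_adjoint B B := pair_adjoint.2.

(** Testing against z turns the vector identity into one between real numbers, which [ring] settles
    once P and Q are distributed and their squares reduced. *)
Lemma pair_sqr x : B (B x) = x - A (A x).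
Proof.
apply: ip_inj => z; rewrite /A /B/= !(linB _ _ lP) !(linB _ _ lQ) !PP !QQ.
by rewrite !(ipDl, ipNl); ring.
Qed.

Lemma pair_anticommute x : B (A x) = - A (B x).
Proof.
apply: ip_inj => z; rewrite /A /B/= !(linB _ _ lP) !(linB _ _ lQ) !PP !QQ.
by rewrite !(ipDl, ipNl); ring.
Qed.

Lemma pair_norm x : nr (A x) ^+ 2 + nr (B x) ^+ 2 = nr x ^+ 2.
Proof.
rewrite -!ipxx (is_adjoint_ip _ _ aA) (is_adjoint_ip _ _ aB) pair_sqr ipBr.
by ring.
Qed.

Lemma pair_contraction : sa_contraction A.
Proof.
split=> // x; rewrite -ler_sqr ?nnegrE ?nr_ge0// -(pair_norm x).
by rewrite lerDl sqr_ge0.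
Qed.
Let sA := pair_contraction.

Lemma pair_B_le x : nr (B x) <= 1 * nr x.
Proof.
by rewrite mul1r -ler_sqr ?nnegrE ?nr_ge0// -(pair_norm x) lerDr sqr_ge0.
Qed.

Let rangeP x : range P x <-> P x = x.
Proof. by split=> [[y _ <-]//|Px]; exists x. Qed.
Let rangeQ x : range Q x <-> Q x = x.
Proof. by split=> [[y _ <-]//|Qx]; exists x. Qed.

(* If Sv - Tv = v for projections S and T, then applying S gives S T v = 0. *)
Lemma proj_sub_fix S T v : linear S -> linear T ->
  (forall x, S (S x) = S x) -> (forall x, T (T x) = T x) ->
  (forall x y, ip (S x) y = ip x (S y)) -> (forall x y, ip (T x) y = ip x (T y)) ->
  S v - T v = v -> S v = v /\ T v = 0.
Proof.
move=> lS lT SS TT ipS ipT STv.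
have STv0 : S (T v) = 0.
  have := congr1 S STv; rewrite (linB _ _ lS) SS => h.
  by apply/eqP; rewrite -oppr_eq0 -(addKr (S v) (- _)) h addNr.
have Tv0 : T v = 0.
  apply/nr_eq0/eqP; rewrite -sqrf_eq0 -ipxx; apply/eqP.
  have : ip (S v - T v) (T v) = ip v (T v) by rewrite STv.
  have -> : ip v (T v) = nr (T v) ^+ 2 by rewrite -ipxx ipT TT.
  by rewrite ipBl ipS STv0 (ipC v 0) ip0l ipxx; lra.
by split=> //; rewrite -{2}STv Tv0 subr0.
Qed.

Lemma range_ker_eigen : range P `&` Defs.ker Q = [set v | A v = 1%:C *: v].
Proof.
apply/seteqP; split=> v /=.
  by move=> [/rangeP Pv Qv]; rewrite /A/= Pv Qv subr0 scale1r.
rewrite scale1r => /(proj_sub_fix lP lQ PP QQ ipP ipQ)[Pv Qv].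
by split=> //; exact/rangeP.
Qed.

Lemma ker_range_eigen : Defs.ker P `&` range Q = [set v | A v = (-1)%:C *: v].
Proof.
apply/seteqP; split=> v /=.
  by move=> [Pv /rangeQ Qv]; rewrite /A/= Pv Qv sub0r rmorphN1 scaleN1r.
rewrite rmorphN1 scaleN1r => Av.
have : Q v - P v = v by rewrite -opprB; move: Av; rewrite /A/= => ->; rewrite opprK.
by move=> /(proj_sub_fix lQ lP QQ PP ipQ ipP)[Qv Pv]; split=> //; exact/rangeQ.
Qed.

(** An operator commuting with N commutes with P and Q, hence with A and B. The bound M on S is
    handed over because the intertwining lemmas ask for it. *)
Lemma vN_mem_pair T : bounded_op T ->
  (forall S (M : R), linear S -> (forall z, nr (S z) <= M * nr z) ->
    (forall z, S (A z) = A (S z)) -> (forall z, S (B z) = B (S z)) ->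
    forall x, S (T x) = T (S x)) -> N T.
Proof.
move=> bT comm; apply: (vN_mem hN) => // S /bounded_opP[lS [M _ SM]] SN.
by apply: (comm _ M) => // z; rewrite /A /B/= !(linB _ _ lS) !(SN P hP, SN Q hQ).
Qed.

Lemma cfc_bounded_op f T : is_cfc f A T -> bounded_op T.
Proof.
move=> fT; apply/bounded_opP; split; first exact: is_cfc_linear fT.
have [M M0 fM] := is_cfc_bounded fT; exists (M + 1) => [|x]; first by lra.
by apply: is_cfc_le fT _ => // t /fM; lra.
Qed.

Lemma cfc_pos_cone f T : is_cfc f A T ->
  (forall t, t \in `[-1, 1] -> 0 <= f t) -> pos_cone N T.
Proof.
move=> fT f0; have bT := cfc_bounded_op fT; apply: (pos_cone_mem hN).
- apply: vN_mem_pair => // S M lS SM SA _ x.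
  exact: (is_cfc_intertwine x sA sA lS SM SA fT fT).
- exact: is_cfc_adjoint fT.
- by move=> x; exact: is_cfc_ge0 fT f0.
Qed.

Lemma poly_opXn n x : poly_op 'X^n A x = iter n A x.
Proof.
elim: n x => [|n IH] x; first by rewrite expr0 poly_op1.
by rewrite exprSr poly_opMX IH -iterSr.
Qed.

Lemma geometric_sum n t :
  (1 - t ^+ 2) * \sum_(j < n) (t ^+ 2) ^+ j = 1 - t ^+ n.*2.
Proof.
have := subrX1 (t ^+ 2) n; rewrite -mul2n exprM; move: (\sum_(_ < _) _) => s.
by move: (t ^+ 2) => v; move: (v ^+ n) => u; lra.
Qed.

Lemma itv11_sqr t : t \in `[-1, 1] -> t ^+ 2 <= 1.
Proof.
by move=> /itv11P[t1 t2]; nra.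
Qed.

Lemma itv11N t : t \in `[-1, 1] -> - t \in `[-1, 1].
Proof. by move=> /itv11P[? ?]; apply/itv11P; split; lra. Qed.

Variable E : H -> H.
Hypothesis AE : even_limit A E.

Definition off_eigen X x := X x - X (E x).

Let lE : linear E := even_limit_linear sA AE.

(* [off_eigen X] is the strong limit of the increasing sequence
   (f(t) (1 - t^2n))(A), for X = f(A). *)
Definition trunc X n x : H := X x - X (iter n.*2 A x).

Lemma trunc_cfc f X n : is_cfc f A X ->
  is_cfc (fun t => f t * (1 - t ^+ n.*2)) A (trunc X n).
Proof.
move=> fX; rewrite (_ : trunc X n = X \o poly_op (1 - 'X^(n.*2)) A).
  apply: is_cfc_ext (is_cfcM sA fX (@is_cfc_poly _ _ (1 - 'X^(n.*2)) A)) => t _.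
  by rewrite !hornerE.
apply/funext => x; rewrite /trunc -(linB _ _ (is_cfc_linear sA fX)) /=.
by rewrite poly_opB poly_op1 poly_opXn.
Qed.

Lemma trunc_ge0 f n t : t \in `[-1, 1] -> 0 <= f t -> 0 <= f t * (1 - t ^+ n.*2).
Proof.
move=> tI f0; rewrite mulr_ge0// -mul2n exprM subr_ge0 exprn_ile1 ?sqr_ge0//.
exact: itv11_sqr.
Qed.

Lemma trunc_pos_cone f X n : is_cfc f A X ->
  (forall t, t \in `[-1, 1] -> 0 <= f t) -> pos_cone N (trunc X n).
Proof.
move=> fX f0; apply: (cfc_pos_cone (trunc_cfc n fX)) => t tI.
by apply: trunc_ge0 => //; exact: f0.
Qed.

Lemma trunc_le f X n m x : is_cfc f A X ->
  (forall t, t \in `[-1, 1] -> 0 <= f t) -> (n <= m)%N ->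
  ip (trunc X n x) x <= ip (trunc X m x) x.
Proof.
move=> fX f0 nm; rewrite -subr_ge0 -ipBl.
have gT := is_cfcD (trunc_cfc m fX) (is_cfcZ (-1) sA (trunc_cfc n fX)).
have -> : trunc X m x - trunc X n x =
    (trunc X m \+ (fun x => (-1)%:C *: trunc X n x)) x.
  by rewrite /= rmorphN1 scaleN1r.
apply: (is_cfc_ge0 _ sA gT) => t tI.
have -> : f t * (1 - t ^+ m.*2) + -1 * (f t * (1 - t ^+ n.*2)) =
  f t * (t ^+ n.*2 - t ^+ m.*2) by ring.
rewrite mulr_ge0 ?f0// -!mul2n !exprM subr_ge0 ler_wiXn2l ?sqr_ge0//.
exact: itv11_sqr.
Qed.

Lemma trunc_cvgs f X x : is_cfc f A X -> cvgs (fun n => trunc X n x) (off_eigen X x).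
Proof.
move=> fX; have [lX [M _ XM]] := (bounded_opP _).1 (cfc_bounded_op fX).
by apply: cvgsD (cvgs_cst _) (cvgsN (cvgs_lin lX XM (AE x))).
Qed.

(** This operator corresponds to f cut off at the two endpoints, in general not a continuous
    function. Positivity is therefore inherited from the truncations, and membership from the
    commutation of both X and E. *)
Lemma off_eigen_pos_cone f X : is_cfc f A X ->
  (forall t, t \in `[-1, 1] -> 0 <= f t) -> pos_cone N (off_eigen X).
Proof.
move=> fX f0; have [lX [M M0 XM]] := (bounded_opP _).1 (cfc_bounded_op fX).
have aX := is_cfc_adjoint sA fX.
have AM z : nr (A z) <= 1 * nr z by rewrite mul1r; case: sA.
have XA z : X (A z) = A (X z).
  by symmetry; exact: (is_cfc_intertwine _ sA sA lA AM _ fX fX).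
have XE x : X (E x) = E (X x) by exact: even_limit_comm lX XM XA.
have lO : linear (off_eigen X).
  by move=> c x y; rewrite /off_eigen lE !lX scalerBr opprD addrACA.
apply: (pos_cone_mem hN).
- apply: vN_mem_pair.
    apply/bounded_opP; split=> //; exists (2 * M) => [|x]; first by lra.
    apply: (le_trans (nrD _ _)); rewrite nrN.
    have := XM x; have := XM (E x).
    by have := ler_wpM2l (ltW M0) (even_limit_le sA AE x); lra.
  move=> S K lS SK SA _ x.
  rewrite /off_eigen (linB _ _ lS) -(even_limit_comm AE x lS SK SA).
  by rewrite !(is_cfc_intertwine _ sA sA lS SK SA fX fX).
- apply: ip_is_adjoint => // x y; rewrite /off_eigen ipBl ipBr.
  by rewrite (is_adjoint_ip _ _ aX) XE (even_limit_ip sA AE) (is_adjoint_ip _ _ aX).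
- move=> x; apply: (cvgs_ip_ge (n0 := 0%N) (trunc_cvgs x fX)) => n _.
  exact: positive_op_ip (trunc_pos_cone n fX f0).2.
Qed.

(* T = s(A) B with s^2 = f (1 + t^2 + ... + t^(2n-2)) gives the two truncations
   as T T^* and T^* T, since B s(A) = s(-A) B and B^2 = 1 - A^2. *)
Lemma trace_trunc f g X Y n : {within `[-1, 1], continuous f} ->
  {within `[-1, 1], continuous g} ->
  (forall t, t \in `[-1, 1] -> 0 <= f t) ->
  (forall t, t \in `[-1, 1] -> g t = f (- t)) ->
  is_cfc f A X -> is_cfc g A Y -> tau (trunc X n) = tau (trunc Y n).
Proof.
move=> fc gc f0 gf fX gY.
pose p : {poly R} := \sum_(j < n) ('X^2) ^+ j.
have pE t : p.[t] = \sum_(j < n) (t ^+ 2) ^+ j.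
  by rewrite /p horner_sum; apply: eq_bigr => j _; rewrite !hornerE.
have p0 t : 0 <= p.[t] by rewrite pE sumr_ge0// => j _; rewrite exprn_ge0 ?sqr_ge0.
have pc := cont_mul fc (@cont_horner _ p); have qc := cont_mul gc (@cont_horner _ p).
have qE t : (1 - 'X^2 : {poly R}).[t] = 1 - t ^+ 2.
  by rewrite hornerD hornerN hornerXn hornerC.
pose s t := Num.sqrt (f t * p.[t]).
have sc : {within `[-1, 1], continuous s}.
  exact: cont_comp (@sqrt_continuous R) pc.
have sS := cfcP sA sc; set S := cfc s A in sS.
have qW := cfcP sA qc; set W := cfc _ A in qW.
have ss t : t \in `[-1, 1] -> s t * s t = f t * p.[t].
  by move=> tI; rewrite -expr2 sqr_sqrtr// mulr_ge0 ?f0.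
have SS := is_cfc_ext ss (is_cfcM sA sS sS).
(* p is even, so W = (g p)(A) is also (f p)(-A). Since B A = (-A) B, this yields B S^2 = W B. *)
have sN : is_cfc (fun t => f t * p.[t]) (fun x => - A x) W.
  apply: is_cfc_ext (is_cfc_opp sA qW) => t tI /=.
  rewrite gf ?itv11N// opprK; congr (_ * _); rewrite !pE.
  by apply: eq_bigr => j _; rewrite sqrrN.
have BSS x : B (S (S x)) = W (B x).
  exact: (is_cfc_intertwine _ sA (sa_contractionN sA) lB pair_B_le
    pair_anticommute SS sN).
have BB x : B (B x) = poly_op (1 - 'X^2) A x.
  by rewrite pair_sqr poly_opB poly_op1 poly_opXn.
have aS := is_cfc_adjoint sA sS.
have bS := cfc_bounded_op sS; have [lS [M M0 SM]] := (bounded_opP _).1 bS.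
pose T := S \o B.
have adjT : adj T = B \o S.
  by apply: adjE => x y; rewrite /T/= aS aB.
have NT : N T.
  apply: vN_mem_pair => [|U K lU UK UA UB x]; last first.
    by rewrite /T/= -UB; exact: (is_cfc_intertwine _ sA sA lU UK UA sS sS).
  apply/bounded_opP; split; first exact: lin_comp.
  exists M => // x; apply: (le_trans (SM _)); rewrite ler_wpM2l ?(ltW M0)//.
  by have := pair_B_le x; rewrite mul1r.
(* T T^* = S B^2 S has symbol s^2 (1 - t^2) = f p (1 - t^2), and the geometric sum telescopes. *)
have -> : trunc X n = T \o adj T.
  apply: (is_cfc_unique sA (trunc_cfc n fX)).
  have := is_cfcM sA sS (is_cfcM sA (@is_cfc_poly _ _ (1 - 'X^2) A) sS).
  rewrite (_ : S \o (_ \o S) = T \o adj T); last first.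
    by rewrite adjT; apply/funext => x; rewrite /T/= BB.
  by apply: is_cfc_ext => t tI; rewrite mulrCA ss// mulrCA pE qE geometric_sum.
(* T^* T = B S^2 B = W B^2 has symbol g p (1 - t^2). *)
have -> : trunc Y n = adj T \o T.
  apply: (is_cfc_unique sA (trunc_cfc n gY)).
  have := is_cfcM sA qW (@is_cfc_poly _ _ (1 - 'X^2) A).
  rewrite (_ : W \o _ = adj T \o T); last first.
    by rewrite adjT; apply/funext => x; rewrite /T/= -BB BSS.
  apply: is_cfc_ext => t tI.
  by rewrite -mulrA [_ * (1 - _).[t]]mulrC pE qE geometric_sum.
by rewrite (trace_adj htau).
Qed.

Lemma trace_off_eigen f g X Y : {within `[-1, 1], continuous f} ->
  {within `[-1, 1], continuous g} ->
  (forall t, t \in `[-1, 1] -> 0 <= f t) ->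
  (forall t, t \in `[-1, 1] -> g t = f (- t)) ->
  is_cfc f A X -> is_cfc g A Y -> tau (off_eigen X) = tau (off_eigen Y).
Proof.
move=> fc gc f0 gf fX gY.
have g0 t : t \in `[-1, 1] -> 0 <= g t by move=> tI; rewrite gf// f0// itv11N.
have tauE h Z (hZ : is_cfc h A Z) (h0 : forall t, t \in `[-1, 1] -> 0 <= h t) :
    tau (off_eigen Z) = ereal_sup (range (tau \o trunc Z)).
  apply: (trace_sup htau).
  - by move=> n; exact: trunc_pos_cone hZ h0.
  - by move=> n m x nm; exact: (trunc_le x hZ h0 nm).
  - exact: off_eigen_pos_cone hZ h0.
  - by move=> x; exact: trunc_cvgs hZ.
rewrite (tauE _ _ fX f0) (tauE _ _ gY g0).
rewrite (_ : tau \o trunc X = tau \o trunc Y)//; apply/funext => n.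
exact: (trace_trunc n fc gc f0 gf fX gY).
Qed.

Lemma eigenproj_pos_cone r : r ^+ 2 = 1 -> pos_cone N (eigenproj A E r).
Proof.
move=> r1; split; last exact: eigenproj_positive.
apply: vN_mem_pair; first exact: eigenproj_bounded.
by move=> S K lS SK SA _ x; exact: (eigenproj_comm AE r x lS SK SA).
Qed.

Lemma cfc_decomposition f X : is_cfc f A X ->
  X = (off_eigen X \+ (fun x => (f 1)%:C *: eigenproj A E 1 x)) \+
      (fun x => (f (-1))%:C *: eigenproj A E (-1) x).
Proof.
move=> fX; apply/funext => x /=; have lX := is_cfc_linear sA fX.
have n1 : (-1 : R) ^+ 2 = 1 by rewrite sqrrN expr1n.
have I1 : 1 \in `[(-1 : R), 1] by apply/itv11P; split; lra.
have IN1 : -1 \in `[(-1 : R), 1] by apply/itv11P; split; lra.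
rewrite -(is_cfc_eigen sA I1 (eigenproj_eigen sA AE x (expr1n _ 2)) fX).
rewrite -(is_cfc_eigen sA IN1 (eigenproj_eigen sA AE x n1) fX).
by rewrite -addrA -(linD _ _ lX) (eigenprojD A E) /off_eigen subrK.
Qed.

Lemma trace_cfc f X : is_cfc f A X -> (forall t, t \in `[-1, 1] -> 0 <= f t) ->
  tau X = (tau (off_eigen X) + (f 1)%:E * tau (eigenproj A E 1) +
           (f (-1))%:E * tau (eigenproj A E (-1)))%E.
Proof.
move=> fX f0; have n1 : (-1 : R) ^+ 2 = 1 by rewrite sqrrN expr1n.
have f10 : 0 <= f 1 by apply: f0; apply/itv11P; split; lra.
have fN10 : 0 <= f (-1) by apply: f0; apply/itv11P; split; lra.
have p1 := eigenproj_pos_cone (expr1n _ 2); have pN1 := eigenproj_pos_cone n1.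
have pO := off_eigen_pos_cone fX f0.
have q1 := pos_coneZ hN f10 p1; have qN1 := pos_coneZ hN fN10 pN1.
rewrite {1}(cfc_decomposition fX) (traceD htau (pos_coneD hN pO q1) qN1).
by rewrite (traceD htau pO q1) (traceZ htau f10 p1) (traceZ htau fN10 pN1).
Qed.

End ProjectionPair.

(** * Solving for the index in the extended reals *)

Section IndexArithmetic.
Context {R : realType}.
Local Open Scope ereal_scope.

Lemma fin_num_weight (u v w : \bar R) (c : R) : 0 <= u -> 0 <= v -> 0 <= w ->
  (0 < c)%R -> u + (c%:E * v + w) < +oo -> v \is a fin_num.
Proof.
move=> u0 v0 w0 c0; rewrite ge0_fin_numE//; case: v v0 => // [r _ _|_].
  by rewrite ltry.
rewrite gt0_muley ?lte_fin// addye ?gt_eqF ?(lt_le_trans _ w0)//.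
by rewrite addey// gt_eqF// (lt_le_trans _ u0).
Qed.

(** Finiteness has to come before any subtraction. As a and b are nonnegative and distinct, one of
    them is positive; d and e each carry that weight in one of the two finite sums, so both are
    finite. Then o cancels. *)
Lemma index_arith (o d e : \bar R) (a b : R) : (0 <= a)%R -> (0 <= b)%R ->
  (a - b != 0)%R -> 0 <= o -> 0 <= d -> 0 <= e ->
  o + a%:E * d + b%:E * e < +oo -> o + b%:E * d + a%:E * e < +oo ->
  d - e = ((a - b)^-1 * (fine (o + a%:E * d + b%:E * e) -
                         fine (o + b%:E * d + a%:E * e)))%:E.
Proof.
move=> a0 b0 ab o0 d0 e0 x_oo y_oo.
have [m0 n0 p0 q0] :
    [/\ 0 <= a%:E * d, 0 <= b%:E * e, 0 <= b%:E * d & 0 <= a%:E * e].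
  by rewrite !mule_ge0// lee_fin.
have o_fin : o \is a fin_num.
  rewrite ge0_fin_numE//; apply: le_lt_trans x_oo.
  by rewrite -addeA leeDl// adde_ge0.
have [d_fin e_fin] : d \is a fin_num /\ e \is a fin_num.
  have [a1|a1] := ltP 0%R a.
    split; first by apply: (fin_num_weight o0 d0 n0 a1); rewrite addeA.
    by apply: (fin_num_weight o0 e0 p0 a1); rewrite [X in o + X]addeC addeA.
  have b1 : (0 < b)%R.
    rewrite lt_neqAle b0 andbT; apply: contra ab => /eqP <-.
    by rewrite subr0 eq_le a0 a1.
  split; first by apply: (fin_num_weight o0 d0 q0 b1); rewrite addeA.
  by apply: (fin_num_weight o0 e0 m0 b1); rewrite [X in o + X]addeC addeA.
rewrite -(fineK o_fin) -(fineK d_fin) -(fineK e_fin) -!EFinM -!EFinD /=.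
by congr EFin; field.
Qed.

End IndexArithmetic.

(** * The index formula, by comparing the traces of the two parts of f(A) *)

Theorem theorem3p1 (R : realType) (H : hilbertType R)
    (N : set (H -> H)) (tau : (H -> H) -> \bar R)
    (hN : von_neumann_algebra N)
    (hsep : separable_predual N)
    (htau : faithful_normal_semifinite_trace N tau)
    (f : R -> R)
    (fcont : {within `[-1, 1], continuous f})
    (fodd : forall t, t \in `[-1, 1] -> f (- t) = - f t)
    (f1 : f 1 != 0)
    (P Q : H -> H)
    (hP : N P) (hPp : is_projection P)
    (hQ : N Q) (hQp : is_projection Q)
    (hPQ : compact_ideal N tau (P \- Q))
    (hf : trace_class N tau (cfc f (P \- Q))) :
  bf_index tau P Q (Q \o P) =
  ((f 1)^-1 * trace_sa N tau (cfc f (P \- Q)))%:E.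
Proof.
have sA := pair_contraction hN hP hPp hQ hQp; set A := P \- Q in hf sA *.
have [E AE] := even_powers_cvg sA.
have n1 : (-1 : R) ^+ 2 = 1 by rewrite sqrrN expr1n.
rewrite bf_index_projE// (range_ker_eigen hN hP hPp hQ hQp).
rewrite (ker_range_eigen hN hP hPp hQ hQp) -/A.
rewrite (proj_eigenproj sA AE (expr1n _ 2)) (proj_eigenproj sA AE n1).
have fnc : {within `[-1, 1], continuous (fun t => `|f t|)}.
  exact: cont_comp (@norm_continuous _ _) fcont.
(* Constants are written as values of constant polynomials, so that [cont_mul], [cont_add] and
   [cont_horner] give continuity. *)
pose fp t := (2^-1)%:P.[t] * (`|f t| + f t).
pose fm t := (2^-1)%:P.[t] * (`|f t| + (-1)%:P.[t] * f t).
have fpE t : fp t = (`|f t| + f t) / 2 by rewrite /fp hornerC mulrC.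
have fmE t : fm t = (`|f t| - f t) / 2 by rewrite /fm !hornerC mulN1r mulrC.
have fpc : {within `[-1, 1], continuous fp}.
  by apply: cont_mul (@cont_horner _ _) _; exact: cont_add.
have fmc : {within `[-1, 1], continuous fm}.
  apply: cont_mul (@cont_horner _ _) _; apply: cont_add => //.
  exact: cont_mul (@cont_horner _ _) _.
have fp0 t : t \in `[-1, 1] -> 0 <= fp t.
  by move=> _; rewrite fpE; have := ler_norm (- f t); rewrite normrN; lra.
have fm0 t : t \in `[-1, 1] -> 0 <= fm t.
  by move=> _; rewrite fmE; have := ler_norm (f t); lra.
have fpm t : t \in `[-1, 1] -> fm t = fp (- t).
  by move=> tI; rewrite fpE fmE fodd// normrN.
have fX := cfcP sA fpc; set X := cfc fp A in fX.
have fY := cfcP sA fmc; set Y := cfc fm A in fY.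
have pX := cfc_pos_cone hN hP hPp hQ hQp fX fp0.
have pY := cfc_pos_cone hN hP hPp hQ hQp fY fm0.
have fF := cfcP sA fcont; set F := cfc f A in hf fF *.
have XY : is_cfc (fun t => `|f t|) A (X \+ Y).
  by apply: is_cfc_ext (is_cfcD fX fY) => t _; rewrite fpE fmE; lra.
have FE : F = X \- Y.
  apply: (is_cfc_unique sA fF).
  have := is_cfcD fX (is_cfcZ (-1) sA fY).
  rewrite (_ : X \+ _ = X \- Y).
    by apply: is_cfc_ext => t _; rewrite fpE fmE; lra.
  by apply/funext => x /=; rewrite rmorphN1 scaleN1r.
(* The hypothesis only supplies some positive M with M^2 = F^* F. Uniqueness of the square root
   identifies it with |f|(A) = X + Y, whence both parts have finite trace. *)
have [_ [M [pM MM] M_oo]] := hf.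
have ME : M = X \+ Y.
  apply: sqrt_unique => //; first exact: (pos_coneD hN pX pY).2.
  rewrite MM (adjE (is_cfc_adjoint sA fF)).
  apply: (is_cfc_unique sA (is_cfcM sA fF fF)).
  apply: is_cfc_ext (is_cfcM sA XY XY) => t _.
  by rewrite -normrM -expr2 ger0_norm ?sqr_ge0// expr2.
rewrite ME in M_oo; have [X_oo Y_oo] := trace_sum_fin htau pX pY M_oo.
have XE := trace_cfc hN htau hP hPp hQ hQp AE fX fp0.
have YE := trace_cfc hN htau hP hPp hQ hQp AE fY fm0.
rewrite FE (trace_saE htau pX X_oo pY Y_oo).
(* Both traces now contain the same term off the eigenspaces, the o of [index_arith]. *)
rewrite -(trace_off_eigen hN htau hP hPp hQ hQp AE fpc fmc fp0 fpm fX fY) in YE.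
have pO := off_eigen_pos_cone hN hP hPp hQ hQp AE fX fp0.
have p1 := eigenproj_pos_cone hN hP hPp hQ hQp AE (expr1n _ 2).
have pN1 := eigenproj_pos_cone hN hP hPp hQ hQp AE n1.
have I1 : 1 \in `[(-1 : R), 1] by apply/itv11P; split; lra.
have fN1 : f (-1) = - f 1 by exact: fodd.
(* With a = (|f 1| + f 1) / 2 and b = (|f 1| - f 1) / 2, oddness makes [fp] take the values a, b at
   1, -1 and [fm] the values b, a; moreover a - b = f 1. *)
rewrite !fpE fN1 normrN in XE; rewrite !fmE fN1 normrN opprK in YE.
rewrite XE in X_oo *; rewrite YE in Y_oo *.
have fp1 := fp0 1 I1; have fm1 := fm0 1 I1; rewrite fpE in fp1; rewrite fmE in fm1.
have fd : (`|f 1| + f 1) / 2 - (`|f 1| - f 1) / 2 = f 1 by field.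
rewrite (index_arith fp1 fm1 _ _ _ _ X_oo Y_oo) ?fd//; exact: (trace_ge0 htau).
Qed.
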